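(* (i) The Eisenstein series $E_u=E_{1,u}$ ($u\in\mathcal T(N)$) of weight $1$ and level $N$ separate points of $\Gamma(N)\backslash\overline{\Psi}^r$. That is, if $\omega,\omega'\in\overline{\Psi}^r$ satisfy $E_u(\omega)=E_u(\omega')$ for all $u\in\mathcal T(N)$, then there exists $\gamma\in\Gamma(N)$ such that $\omega'=\gamma\omega$. (ii) The same holds with $\Gamma(N)\backslash\overline{\Psi}^r$ replaced by $\Gamma(N)\backslash\overline{\Omega}^r$: if $\omega,\omega'\in\overline{\Psi}^r$ are such that the vectors $(E_u(\omega))_{u\in\mathcal T(N)}$ and $(E_u(\omega'))_{u\in\mathcal T(N)}$ agree up to a common factor in $C_\infty^*$, then there exists $\gamma\in\Gamma(N)$ such that $\gamma$ maps the class of $\omega$ in $\overline{\Omega}^r$ to the class of $\omega'$.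
   Context: $\mathbb F=\mathbb F_q$ is the finite field with $q$ elements, $A=\mathbb F[T]$, $K=\mathbb F(T)$, $K_\infty=\mathbb F((T^{-1}))$, and $C_\infty$ is the completed algebraic closure of $K_\infty$. $r\ge2$ is an integer, $N\in A$ is monic of degree $d\ge1$, $\Gamma=\mathrm{GL}(r,A)$, $\Gamma(N)=\{\gamma\in\Gamma:\gamma\equiv1\ (\mathrm{mod}\ N)\}$. $V=K^r$ (row vectors), $\mathfrak U$ is the set of $K$-subspaces $U\ne0$ of $V$, $L_U=U\cap A^r$. A discrete embedding of $U$ is an injective $K$-linear map $i:U\to C_\infty$ such that $i(L_U)$ meets every ball of finite radius in a finite set. $\Psi_U$ is the set of discrete embeddings of $U$ (elements written $(U,i)$), $\Omega_U=C_\infty^*\backslash\Psi_U$, $\overline{\Psi}^r=\bigsqcup_{U\in\mathfrak U}\Psi_U$, $\overline{\Omega}^r=\bigsqcup_{U\in\mathfrak U}\Omega_U=C_\infty^*\backslash\overline{\Psi}^r$. $\gamma\in\Gamma$ acts by $\gamma(U,i)=(U\gamma^{-1},i\circ r_\gamma)$, $r_\gamma(x)=x\gamma$. $\mathcal T(N)=(N^{-1}A/A)^r\setminus\{0\}$. For $u\in\mathcal T(N)$ and $(U,i)\in\overline{\Psi}^r$, $$E_{1,u}(U,i)=\sum_{0\neq\lambda\in U,\ \lambda\equiv u\ (\mathrm{mod}\ A^r)}i(\lambda)^{-1},$$ (an empty sum is $0$). It satisfies $E_{1,u}(U,c\,i)=c^{-1}E_{1,u}(U,i)$ for $c\in C_\infty^*$.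 *)

(* Defs.v *)
From HB Require Import structures.
From mathcomp Require Import all_boot all_order all_algebra finmap.
From mathcomp Require Import boolp classical_sets functions cardinality filter reals.
From mathcomp Require Import topology normedtype summability.

Set Implicit Arguments.
Unset Strict Implicit.
Unset Printing Implicit Defensive.

Import Order.TTheory GRing.Theory Num.Theory.
Local Open Scope classical_set_scope.
Local Open Scope ring_scope.

(* [normedZmodType] does not apply to fields of positive characteristic, since
   it imposes `|x *+ n| = `|x| *+ n. *)
Record nonarch_absval (R : realType) (C : fieldType) := NonarchAbsval {
  absv :> C -> R;
  absv_ge0 : forall x, 0 <= absv x;
  absv_eq0 : forall x, (absv x == 0) = (x == 0);
  absvM : forall x y, absv (x * y) = absv x * absv y;
  absv_ultra : forall x y, absv (x + y) <= Num.max (absv x) (absv y)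
}.

(* The field C with the metric v (x - y). *)
Definition valued (R : realType) (C : fieldType) (v : nonarch_absval R C) :
  Type := C.

Section ValuedTopology.
Variables (R : realType) (C : fieldType) (v : nonarch_absval R C).

HB.instance Definition _ := GRing.Field.on (valued v).
HB.instance Definition _ := isPointed.Build (valued v) 0.

Definition vdist (x y : valued v) : R := v (x - y).

Let vdistxx x : vdist x x = 0.
Proof. by rewrite /vdist subrr; apply/eqP; rewrite absv_eq0. Qed.

Let vdist_positivity x y : vdist x y = 0 -> x = y.
Proof. by move=> /eqP; rewrite absv_eq0 subr_eq0 => /eqP. Qed.

Let absvN (x : C) : v (- x) = v x.
Proof.
apply/eqP; rewrite -(@eqrXn2 _ 2) ?absv_ge0// !expr2 -!absvM.
by rewrite mulrNN.
Qed.

Let vdist_sym x y : vdist x y = vdist y x.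
Proof. by rewrite /vdist -absvN opprB. Qed.

Let vdist_triangle y x z : vdist x z <= vdist x y + vdist y z.
Proof.
rewrite /vdist -(subrKA y x (- z)); apply: le_trans (absv_ultra _ _ _) _.
by rewrite ge_max lerDl lerDr !absv_ge0.
Qed.

HB.instance Definition _ := isMetric.Build R (valued v)
  vdistxx vdist_positivity vdist_sym vdist_triangle.

End ValuedTopology.

Section CompletedAlgebraicClosure.
Variables (F : finFieldType) (R : realType) (C : fieldType).
Variable v : nonarch_absval R C.
Variable iota : {rmorphism {fraction {poly F}} -> valued v}.

(* K_oo = F((1/T)): the sums in C of the Laurent series
   T^m * (a_0 + a_1 T^-1 + a_2 T^-2 + ...), where T = 'X. *)
Definition Kinf : set (valued v) :=
  [set x | exists (m : nat) (a : nat -> F),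
    (fun n => \sum_(0 <= k < n)
       iota (tofrac (a k)%:P * tofrac 'X ^+ m / tofrac 'X ^+ k)) @ \oo --> x].

Definition Kinf_alg : set (valued v) :=
  [set x | exists p : {poly valued v},
    [/\ p != 0, forall j, Kinf p`_j & root p x]].

(* C, with its absolute value v and its K-algebra structure iota, is the
   completion of an algebraic closure of K_oo. *)
Record is_Cinfty : Prop := {
  Cinfty_absv : forall a : {poly F}, a != 0 ->
    v (iota (tofrac a)) = #|F|%:R ^+ (size a).-1;
  Cinfty_complete : forall G : set_system (valued v),
    ProperFilter G -> cauchy G -> cvg G;
  Cinfty_alg_closed : forall p : {poly valued v},
    (1 < size p)%N -> (forall j, Kinf_alg p`_j) ->
    exists2 x, Kinf_alg x & root p x;
  Cinfty_dense : closure Kinf_alg = setT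
}.

End CompletedAlgebraicClosure.

Section DiscreteEmbeddings.
Variables (F : finFieldType) (R : realType) (C : fieldType).
Variable v : nonarch_absval R C.
Variable iota : {rmorphism {fraction {poly F}} -> valued v}.
Variable r : nat.

Local Notation A := {poly F}.
Local Notation K := {fraction {poly F}}.
Local Notation V := 'rV[{fraction {poly F}}]_r.

(* A^r inside K^r. *)
Definition Alattice : set V := range (map_mx (@tofrac A) : 'rV[A]_r -> V).

Definition lattice_of (U : {vspace V}) : set (subvs_of U) :=
  [set x | Alattice (vsval x)].
Arguments lattice_of : clear implicits.

Record discrete_embedding (U : {vspace V}) := DiscreteEmbedding {
  demb :> {linear subvs_of U -> valued v | iota \; *%R};
  demb_inj : injective demb;
  demb_discrete : forall (z : valued v) (e : R),
    finite_set (demb @` lattice_of U `&` ball z e)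
}.

Definition PsiBar :=
  {U : {U : {vspace V} | U != 0%VS} & discrete_embedding (val U)}.

Definition Gamma := {g : 'M[A]_r | g \in unitmx}.

Definition in_GammaN (N : A) (g : Gamma) : Prop :=
  forall j k, (N %| (val g - 1%:M) j k)%R.

Section Action.
Variable g : Gamma.

Definition rmul : V -> V := mulmxr (map_mx (@tofrac A) (val g)).
Definition rmulV : V -> V := mulmxr (map_mx (@tofrac A) (invmx (val g))).

Lemma rmulK : cancel rmul rmulV.
Proof.
move=> x; rewrite /rmul /rmulV /= -mulmxA -map_mxM mulmxV ?(valP g)//.
by rewrite map_mx1 mulmx1.
Qed.

Lemma rmulVK : cancel rmulV rmul.
Proof.
move=> x; rewrite /rmul /rmulV /= -mulmxA -map_mxM mulVmx ?(valP g)//.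
by rewrite map_mx1 mulmx1.
Qed.

Definition space_act (U : {vspace V}) : {vspace V} :=
  (linfun (mulmxr (map_mx (@tofrac A) (invmx (val g)))) @: U)%VS.

Lemma mem_space_act U x : (x \in space_act U) = (rmul x \in U).
Proof.
apply/memv_imgP/idP => [[u uU ->]|xU].
  by rewrite lfunE /= -/(rmulV u) rmulVK.
by exists (rmul x) => //; rewrite lfunE; apply/esym/rmulK.
Qed.

Lemma space_act_neq0 U : U != 0%VS -> space_act U != 0%VS.
Proof.
apply: contraNneq => U0; rewrite -subv0; apply/subvP => x xU.
have : rmulV x \in space_act U by rewrite mem_space_act rmulVK.
rewrite U0 !memv0 => /eqP x0; rewrite -(rmulVK x) x0.
by rewrite /rmul /= mul0mx.
Qed.

Section Embedding.
Variables (U : {vspace V}) (i : discrete_embedding U).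

Definition emb_act (x : subvs_of (space_act U)) : valued v :=
  i (vsproj U (rmul (vsval x))).

Fact emb_act_linear : linear_for (iota \; *%R) emb_act.
Proof. by move=> a x y; rewrite /emb_act /rmul !linearP. Qed.

HB.instance Definition _ :=
  GRing.isLinear.Build _ _ _ _ emb_act emb_act_linear.

Fact emb_act_inj : injective emb_act.
Proof.
move=> x y /demb_inj /(congr1 vsval).
rewrite !vsprojK -?mem_space_act ?subvsP// => /(can_inj rmulK).
exact: val_inj.
Qed.

Fact emb_act_discrete (z : valued v) (e : R) :
  finite_set (emb_act @` lattice_of (space_act U) `&` ball z e).
Proof.
apply: sub_finite_set (demb_discrete i z e) => _ [[x xL <-] xe]; split=> //.
exists (vsproj U (rmul (vsval x))) => //.
rewrite /lattice_of /= vsprojK -?mem_space_act ?subvsP//.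
case: xL => a _ ax; exists (a *m val g) => //.
by rewrite map_mxM ax.
Qed.

Definition dembedding_act : discrete_embedding (space_act U) :=
  DiscreteEmbedding emb_act_inj emb_act_discrete.

End Embedding.

Definition Gact (w : PsiBar) : PsiBar :=
  existT (fun U : {U : {vspace V} | U != 0%VS} => discrete_embedding (val U))
    (exist _ (space_act (val (tag w))) (space_act_neq0 (valP (tag w))))
    (dembedding_act (tagged w)).

End Action.

Section Scaling.
Variable c : {c : valued v | c != 0}.

Section Embedding.
Variables (U : {vspace V}) (i : discrete_embedding U).

Definition emb_scale (x : subvs_of U) : valued v := val c * i x.

Fact emb_scale_linear : linear_for (iota \; *%R) emb_scale.
Proof.
by move=> a x y; rewrite /emb_scale linearP mulrDr /= mulrCA.
Qed.

HB.instance Definition _ :=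
  GRing.isLinear.Build _ _ _ _ emb_scale emb_scale_linear.

Fact emb_scale_inj : injective emb_scale.
Proof. by move=> x y /(mulfI (valP c)) /demb_inj. Qed.

Fact emb_scale_discrete (z : valued v) (e : R) :
  finite_set (emb_scale @` lattice_of U `&` ball z e).
Proof.
have c0 : 0 < v (val c) by rewrite lt_def absv_eq0 (valP c) absv_ge0.
apply: sub_finite_set (finite_image ( *%R (val c))
  (demb_discrete i ((val c)^-1 * z) (e / v (val c)))) => _ [[x xL <-] xe].
exists (i x) => //; split; first by exists x.
move: xe; rewrite !ballEmdist /= /mdist /= /vdist ltr_pdivlMr// mulrC -absvM.
by rewrite mulrBr mulVKf ?(valP c).
Qed.

Definition dembedding_scale : discrete_embedding U :=
  DiscreteEmbedding emb_scale_inj emb_scale_discrete.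

End Embedding.

Definition Cscale (w : PsiBar) : PsiBar :=
  existT (fun U : {U : {vspace V} | U != 0%VS} => discrete_embedding (val U))
    (tag w) (dembedding_scale (tagged w)).

End Scaling.

(* The point of OmegaBar = C^* \ PsiBar below w, as an orbit. *)
Definition Omega_class (w : PsiBar) : set PsiBar := range (Cscale ^~ w).

(* (N^-1 A / A)^r \ {0}, its elements being cosets of A^r in K^r. *)
Definition calT (N : A) : set (set V) :=
  [set u | exists x : V, [/\ Alattice (tofrac N *: x), ~ Alattice x &
    u = [set y | Alattice (y - x)]]].

(* The infinite sum is the limit of the sums over the finite sets of vectors. *)
Definition Eis1 (u : set V) (w : PsiBar) : valued v :=
  lim ((fun S : {fset subvs_of (val (tag w))} =>
    \sum_(x <- S | (x != 0) && (vsval x \in u)) (tagged w x)^-1) @ totally).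

End DiscreteEmbeddings.

(* Main.v *)
Require Import Defs.
From HB Require Import structures.
From mathcomp Require Import all_boot all_order all_algebra finmap.
From mathcomp Require Import generic_quotient perm ring lra.
From mathcomp Require Import boolp classical_sets functions cardinality filter reals.
From mathcomp Require Import topology normedtype summability.

(** Write a point of [PsiBar] as [(U, i)], with lattice [D = i (L_U)], and put
    [G z = \sum_(x in D) (z + x)^-1] (the function [invsum]). For a torsion class
    [u] meeting [U] in [c], the value of the Eisenstein series at [u] is
    [G (i c)]; if [u] does not meet [U] the value is [0].

    Classically [G = 1 / e], where [e] is the exponential function of [D], but
    only two facts about it are needed, both of which hold for finite subgroups
    and pass to the limit. The reciprocal of [G] is additive
    ([subgroup_sum_inv_mul], [invsum_mul]), and [G] has no zero off [D]
    ([subgroup_sum_inv_prod], [invsum_neq0]). The second shows that the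
    nonvanishing of the series tells which classes meet [U]. By the first,
    [G (z + i c)] is a rational function of [G z] and [G (i c)], so that
    distributing the sum over [N^-1 D] into cosets of [D] expresses [G (N z)]
    through [G z] and the values of the series alone. As [G z] is close to [1 / z]
    near [0] and [N] is expanding, this functional equation has a unique solution
    ([torsion_system_unique]): two points with the same values of the series have
    the same lattice [D] and the same function [G]. Moreover [G] is injective
    modulo [D], so that a class takes the same values of the embeddings at both
    points ([classes_match]).

    Thus [i'^-1 i] is an isomorphism from [L_U] to [L_U'] congruent to the identity
    modulo [N]. Its extension to an element of [Gamma(N)] ([lattice_iso_extends])
    is linear algebra over [A]. The lattice [L_U] is spanned by the first vectors
    of a basis of [A^r] ([coordinate_subspace]). In coordinates adapted to [U], the
    images of these vectors are the rows of a right-invertible matrix congruent to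
    [(1 0)] modulo [N], and such a matrix is completed within [Gamma(N)]
    ([unimodular_rows_orbit]), which rests on Bezout's identity in rank two.

    The second part follows from the first by scaling [w], as the series have
    weight one. *)

Set Implicit Arguments.
Unset Strict Implicit.
Unset Printing Implicit Defensive.

Import Order.TTheory GRing.Theory Num.Theory.
Local Open Scope classical_set_scope.
Local Open Scope ring_scope.

(** * Ultrametric absolute values *)

Section AbsoluteValue.
Context {R : realType} {C : fieldType} {v : nonarch_absval R C}.
Implicit Types x y z : valued v.

(* The axioms of the absolute value, for the ring operations of [valued v]. *)
Lemma vge0 x : 0 <= v x. Proof. exact: absv_ge0. Qed.

Lemma veq0 x : (v x == 0) = (x == 0). Proof. exact: absv_eq0. Qed.

Lemma vM x y : v (x * y) = v x * v y. Proof. exact: absvM. Qed.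

Lemma v0 : v (0 : valued v) = 0. Proof. by apply/eqP; rewrite veq0. Qed.

Lemma v1 : v (1 : valued v) = 1.
Proof.
have n0 : v (1 : valued v) != 0 by rewrite veq0 oner_neq0.
by apply: (mulfI n0); rewrite -vM !mulr1.
Qed.

Lemma vgt0 x : (0 < v x) = (x != 0).
Proof. by rewrite lt_def veq0 vge0 andbT. Qed.

Lemma vN x : v (- x) = v x.
Proof.
apply/eqP; rewrite -(@eqrXn2 _ 2) ?vge0// !expr2 -!vM.
by rewrite mulrNN.
Qed.

Lemma vB x y : v (x - y) = v (y - x).
Proof. by rewrite -vN opprB. Qed.

Lemma vV x : v x^-1 = (v x)^-1.
Proof.
have [->|x0] := eqVneq x 0; first by rewrite invr0 v0 invr0.
have vx0 : v x != 0 by rewrite veq0.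
by apply: (mulfI vx0); rewrite -vM !mulfV// v1.
Qed.

Lemma v_add_le x y B : v x <= B -> v y <= B -> v (x + y) <= B.
Proof. by move=> xB yB; apply: le_trans (absv_ultra _ _ _) _; rewrite ge_max xB. Qed.

Lemma v_sub_le x y B : v x <= B -> v y <= B -> v (x - y) <= B.
Proof. by move=> xB yB; apply: v_add_le; rewrite ?vN. Qed.

Lemma v_add_lt x y B : v x < B -> v y < B -> v (x + y) < B.
Proof. by move=> xB yB; apply: le_lt_trans (absv_ultra _ _ _) _; rewrite gt_max xB. Qed.

(** Otherwise [x = (x + y) - y] would be smaller than itself. *)
Lemma v_dom x y : v y < v x -> v (x + y) = v x.
Proof.
move=> yx; apply/le_anti/andP; split; first by apply: v_add_le; rewrite // ltW.
rewrite leNgt; apply/negP => lt.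
have : v (x + y - y) < v x by apply: v_add_lt => //; rewrite vN.
by rewrite addrK ltxx.
Qed.

Lemma v_sum_le (I : Type) (s : seq I) (P : pred I) (f : I -> valued v) (B : R) :
  0 <= B -> (forall i, P i -> v (f i) <= B) -> v (\sum_(i <- s | P i) f i) <= B.
Proof.
move=> B0 fB; elim/big_ind: _ => //; first by rewrite v0.
by move=> x y; apply: v_add_le.
Qed.

Lemma v_prod (I : Type) (s : seq I) (P : pred I) (f : I -> valued v) :
  v (\prod_(i <- s | P i) f i) = \prod_(i <- s | P i) v (f i).
Proof. by apply: (big_morph (fun x : valued v => v x) vM v1). Qed.

Lemma v_fin_bound (I : finType) (f : I -> valued v) :
  exists2 B : R, 0 < B & forall i, v (f i) <= B.
Proof.
exists (1 + \sum_i v (f i)).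
  by rewrite ltr_wpDr// sumr_ge0// => i _; apply: vge0.
move=> i; rewrite (bigD1 i)//= addrCA lerDl addr_ge0// sumr_ge0// => j _.
exact: vge0.
Qed.

(** Bernoulli's inequality. *)
Lemma ltr_pow_ex (a x : R) : 1 < a -> exists k, x < a ^+ k.
Proof.
move=> a1; pose b := a - 1; have b0 : 0 < b by rewrite subr_gt0.
have ber k : 1 + k%:R * b <= a ^+ k.
  elim: k => [|k IH]; first by rewrite mul0r addr0 expr0.
  rewrite exprS; apply: le_trans (ler_wpM2l (ltW (lt_trans ltr01 a1)) IH).
  have : 0 <= k%:R * b * b by rewrite !mulr_ge0// ltW.
  by rewrite /b -natr1; set c := k%:R; lra.
pose k := Num.bound `|x / b|.
have kx : `|x / b| < k%:R by apply: archi_boundP; apply: normr_ge0.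
exists k; apply: lt_le_trans (ber k).
have : x / b < k%:R by apply: le_lt_trans (ler_norm _) kx.
by rewrite ltr_pdivrMr// => h; lra.
Qed.

End AbsoluteValue.

(** * Recovering a lattice from its torsion values *)

Section TorsionSystem.
Context {R : realType} {C : fieldType} {v : nonarch_absval R C}.
Variables (n : valued v) (n_gt1 : 1 < v n) (I : finType) (E : I -> valued v).

(** For a lattice [D] with exponential function [e], the function [G] is [1/e]
    off [D], and [E] lists the values of [G] at representatives of the nonzero
    classes of [n^-1 D / D], possibly completed by zeros. As [e] is injective
    modulo [D], the points of [n^-1 D] off [D] are those where [G] takes a value
    of [E] ([ts_mem]). As [e] is additive, the summands of [ts_dist] are the
    [G (z + u)] for [u] in the nonzero classes, and the equation decomposes
    [n^-1 D] into cosets of [D]. *)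
Record torsion_system (D : set (valued v)) (G : valued v -> valued v) : Prop :=
  TorsionSystem {
  ts0 : D 0;
  tsM : forall z, D z -> D (n * z);
  ts_neq0 : forall z, ~ D z -> G z != 0;
  ts_mem : forall z, ~ D z -> (D (n * z) <-> exists t, E t = G z);
  ts_dist : forall z, ~ D (n * z) ->
    n * G (n * z) = G z + \sum_t G z * E t / (G z + E t);
  ts_pole : exists2 b : R, 0 < b & forall z, z != 0 -> v z * b < 1 ->
    ~ D z /\ v (G z - z^-1) <= b
}.

Let vn0 : 0 < v n. Proof. exact: lt_trans n_gt1. Qed.
Let n0 : n != 0. Proof. by rewrite -vgt0. Qed.

Lemma v_near_pole b (z g : valued v) :
  z != 0 -> v z * b < 1 -> v (g - z^-1) <= b -> v g = (v z)^-1.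
Proof.
move=> z0 zb gb; rewrite -(subrK z^-1 g) addrC v_dom vV//.
by apply: le_lt_trans gb _; rewrite -[ltRHS]mul1r ltr_pdivlMr ?vgt0// mulrC.
Qed.

(** The difference is [(g - g') (e / (g + e)) (e / (g' + e))], and [g], [g']
    dominate [e]. *)
Lemma lipschitz_near_pole b (z g g' e : valued v) :
  z != 0 -> v z * b < 1 -> v g = (v z)^-1 -> v g' = (v z)^-1 -> v e <= b ->
  v (g * e / (g + e) - g' * e / (g' + e)) <= v (g - g').
Proof.
move=> z0 zb vg vg' eb.
have vz : 0 < v z by rewrite vgt0.
have ez : v e < (v z)^-1.
  by apply: le_lt_trans eb _; rewrite -[ltRHS]mul1r ltr_pdivlMr// mulrC.
have vs : v (g + e) = (v z)^-1 by rewrite v_dom ?vg.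
have vs' : v (g' + e) = (v z)^-1 by rewrite v_dom ?vg'.
have s0 : g + e != 0 by rewrite -vgt0 vs invr_gt0.
have s0' : g' + e != 0 by rewrite -vgt0 vs' invr_gt0.
have -> : g * e / (g + e) - g' * e / (g' + e)
          = (g - g') * (e / (g + e)) * (e / (g' + e)) by field; apply/andP; split.
rewrite 2!vM -mulrA ler_piMr ?vge0// !vM !vV vs vs' !invrK.
by rewrite mulr_ile1 ?mulr_ge0 ?vge0// -ler_pdivlMr// mul1r ltW.
Qed.

(** Two systems with the same values have functions at bounded distance near
    [0], as both are close to [z^-1]. By [ts_dist] and the previous bound,
    going from [z / n] to [z] divides the distance by [v n > 1]: the functions
    agree near [0]. The equations [ts_mem] and [ts_dist] then propagate the
    agreement of lattices and functions from a ball to its multiple by [n]. *)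
Lemma torsion_system_unique D G D' G' :
  torsion_system D G -> torsion_system D' G' ->
  D = D' /\ forall z, ~ D z -> G z = G' z.
Proof.
move=> S S'.
have [b1 b1_gt0 pole] := ts_pole S; have [b2 b2_gt0 pole'] := ts_pole S'.
have [b3 b3_gt0 Eb] := v_fin_bound E.
pose b := b1 + b2 + b3; have b_gt0 : 0 < b by rewrite !addr_gt0.
have [b1b b2b b3b] : [/\ b1 <= b, b2 <= b & b3 <= b] by split; rewrite /b; lra.
have near z : z != 0 -> v z * b < 1 ->
    [/\ ~ D z, ~ D' z & v (G z - z^-1) <= b /\ v (G' z - z^-1) <= b].
  move=> z0 zb.
  have [|? ?] := pole z z0; first by apply: le_lt_trans zb; rewrite ler_wpM2l ?vge0.
  have [|? ?] := pole' z z0; first by apply: le_lt_trans zb; rewrite ler_wpM2l ?vge0.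
  by split => //; split; [apply: le_trans b1b|apply: le_trans b2b].
have contract k : forall z, z != 0 -> v z * b < 1 ->
    v (G z - G' z) <= b / v n ^+ k.
  elim: k => [|k IH] z z0 zb.
    have [_ _ [Gz G'z]] := near z z0 zb.
    by rewrite expr0 divr1 -(subrKA z^-1); apply: v_add_le; rewrite // vB.
  pose y := z / n; have zE : z = n * y by rewrite /y mulrC divfK.
  have y0 : y != 0 by rewrite mulf_neq0 ?invr_eq0.
  have yb : v y * b < 1.
    apply: le_lt_trans zb; rewrite ler_pM2r// zE vM.
    by rewrite ler_peMl ?vge0// ltW.
  have [_ _ [Gy G'y]] := near y y0 yb.
  have [nD nD' _] := near z z0 zb.
  have vGy := v_near_pole y0 yb Gy; have vG'y := v_near_pole y0 yb G'y.
  have -> : G z - G' z = n^-1 * ((G y - G' y) +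
      \sum_t (G y * E t / (G y + E t) - G' y * E t / (G' y + E t))).
    apply: (mulfI n0); rewrite mulVKf// sumrB addrACA -opprD mulrBr.
    have := ts_dist S (z := y); have := ts_dist S' (z := y).
    by rewrite -zE => -> // ->.
  rewrite vM vV exprS invfM mulrCA ler_pM2l ?invr_gt0//.
  apply: le_trans (IH y y0 yb); apply: v_add_le => //.
  apply: v_sum_le => [|t _]; first exact: vge0.
  by apply: (lipschitz_near_pole y0 yb) => //; apply: le_trans b3b.
have local z : z != 0 -> v z * b < 1 -> G z = G' z.
  move=> z0 zb; apply/eqP; rewrite -subr_eq0 -veq0.
  apply/negPn; rewrite veq0 -vgt0; apply/negP => pos.
  have [k] := ltr_pow_ex (b / v (G z - G' z)) n_gt1.
  rewrite ltr_pdivrMr// -ltr_pdivrMl ?exprn_gt0// mulrC ltNge.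
  by rewrite contract.
have spread k : forall z, v z * b < v n ^+ k ->
    (D z <-> D' z) /\ (~ D z -> G z = G' z).
  elim: k => [|k IH] z zb.
    have [->|z0] := eqVneq z 0; first by have := ts0 S; have := ts0 S'; split.
    by have [? ? _] := near z z0 zb; split => // _; apply: local.
  pose y := z / n; have zE : z = n * y by rewrite /y mulrC divfK.
  have [DD GG] : (D y <-> D' y) /\ (~ D y -> G y = G' y).
    apply: IH; rewrite /y vM vV mulrAC ltr_pdivrMr//.
    by rewrite -exprSr.
  have [Dy|nDy] := pselect (D y).
    have Dz : D z by rewrite zE; apply: (tsM S).
    have D'z : D' z by rewrite zE; apply: (tsM S'); apply/DD.
    by split=> // /(_ Dz).
  have nD'y : ~ D' y by move/DD.
  have Gy := GG nDy.
  have DDz : D z <-> D' z.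
    by rewrite zE (ts_mem S)// (ts_mem S')// Gy.
  split => // nDz; have nD'z : ~ D' z by move/DDz.
  apply: (mulfI n0).
  have := ts_dist S (z := y); have := ts_dist S' (z := y).
  by rewrite -zE => -> // ->; rewrite // Gy.
have all z : (D z <-> D' z) /\ (~ D z -> G z = G' z).
  by have [k /spread] := ltr_pow_ex (v z * b) n_gt1.
split=> [|z /(proj2 (all z))//].
by apply/seteqP; split=> z /(proj1 (all z)).
Qed.

End TorsionSystem.

(** * Unconditional sums *)

#[local] Existing Instance totally_filter.

Section Sums.
Context {R : realType} {C : fieldType} {v : nonarch_absval R C}.
Context {X : choiceType}.
Implicit Types (f g : X -> valued v) (s t : valued v).

Definition has_sum f s :=
  (fun S : {fset X} => \sum_(x <- S) f x) @ totally --> s.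

Lemma has_sumP f s : has_sum f s <-> forall e : R, 0 < e ->
  exists S0 : {fset X}, forall S : {fset X}, (S0 `<=` S)%fset ->
    v (s - \sum_(x <- S) f x) < e.
Proof.
rewrite /has_sum; split=> [|h].
  move=> /cvg_ballP h e e0; have [S0 _ S0h] := h e e0.
  by exists S0 => S /S0h; rewrite ballEmdist.
apply/cvg_ballP => e e0; have [S0 S0h] := h e e0.
by exists S0 => // S /S0h; rewrite /= ballEmdist.
Qed.

Lemma has_sum_unique f s t : has_sum f s -> has_sum f t -> s = t.
Proof.
move=> /has_sumP hs /has_sumP ht; apply/eqP; rewrite -subr_eq0 -veq0.
apply/negPn; rewrite veq0 -vgt0; apply/negP => pos.
have [S hS] := hs _ pos; have [T hT] := ht _ pos.
have := hS (S `|` T)%fset (fsubsetUl _ _); have := hT (S `|` T)%fset (fsubsetUr _ _).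
set u := \sum_(x <- _) _; rewrite vB => tu su.
by have := v_add_lt su tu; rewrite subrKA ltxx.
Qed.

Lemma lim_has_sum f s : has_sum f s ->
  lim ((fun S : {fset X} => \sum_(x <- S) f x) @ totally) = s.
Proof.
move=> fs; apply: (has_sum_unique (f := f)) => //.
by apply: (getPex (P := fun l : valued v => has_sum f l)); exists s.
Qed.

(** Off the finite set of large terms all partial sums are small, the
    ultrametric inequality being insensitive to the number of terms. *)
Lemma summable_of_finite f :
  (forall G : set_system (valued v), ProperFilter G -> cauchy G -> cvg G) ->
  (forall e : R, 0 < e -> finite_set [set x | e <= v (f x)]) ->
  exists s, has_sum f s.
Proof.
move=> complete fin.
exists (lim ((fun S : {fset X} => \sum_(x <- S) f x) @ totally)).
apply: complete; apply/cauchyP => e e0.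
exists (\sum_(x <- fset_set [set x | (e / 2) <= v (f x)]) f x).
(* The ultrametric bound is not strict: hence half of [e]. *)
have e20 : 0 < e / 2 by rewrite divr_gt0.
exists (fset_set [set x | (e / 2) <= v (f x)]) => // S sub /=.
rewrite ballEmdist /= /mdist /= /vdist vB.
apply: (@le_lt_trans _ _ (e / 2)); last by rewrite ltr_pdivrMr// ltr_pMr// ltr1n.
rewrite (big_fsetID _ (mem (fset_set [set x | (e / 2) <= v (f x)]))) /=.
have -> : [fset x in S | x \in fset_set [set x | (e / 2) <= v (f x)]]%fset
          = fset_set [set x | (e / 2) <= v (f x)].
  by apply/fsetP => x; rewrite !inE /= andb_idl// => /(fsubsetP sub).
rewrite [X in v X]addrC addKr big_seq; apply: v_sum_le => [|x]; first exact: ltW.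
rewrite !inE /= => /andP[_]; rewrite in_fset_set; last exact: fin.
by rewrite notin_setE /= => /negP; rewrite -ltNge => /ltW.
Qed.

Lemma has_sum_le f s (B : R) :
  0 <= B -> (forall x, v (f x) <= B) -> has_sum f s -> v s <= B.
Proof.
move=> B0 fB /has_sumP fs; rewrite leNgt; apply/negP => Bs.
have s0 : 0 < v s by apply: le_lt_trans Bs.
have [S0 /(_ S0 (fsubset_refl _))] := fs _ s0.
set u := \sum_(x <- _) _ => su.
have uB : v u <= B by apply: v_sum_le.
have : v (s - u + u) < v s by apply: v_add_lt => //; apply: le_lt_trans uB Bs.
by rewrite subrK ltxx.
Qed.

Lemma has_sum_dominated f s (B : R) (S0 : {fset X}) :
  0 <= B -> (forall x, x \notin S0 -> v (f x) <= B) -> has_sum f s ->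
  v (s - \sum_(x <- S0) f x) <= B.
Proof.
move=> B0 fB /has_sumP fs; rewrite leNgt; apply/negP => Bs.
have s0 : 0 < v (s - \sum_(x <- S0) f x) by apply: le_lt_trans Bs.
have [S1 /(_ (S0 `|` S1)%fset (fsubsetUr _ _))] := fs _ s0.
rewrite (big_fsetID _ (mem S0)) /=.
have -> : [fset x in (S0 `|` S1) | x \in S0]%fset = S0.
  by apply/fsetP => x; rewrite !inE /=; case: (x \in S0); rewrite ?andbF.
set u := \sum_(x <- S0) _ in Bs s0 *; set w := \sum_(x <- _) _ => su.
have wB : v w <= B.
  by rewrite /w big_seq; apply: v_sum_le => // x; rewrite !inE => /andP[_ /fB].
have : v (s - (u + w) + w) < v (s - u).
  by apply: v_add_lt => //; apply: le_lt_trans wB Bs.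
by rewrite opprD addrA subrK ltxx.
Qed.

Lemma eq_has_sum f g s : f =1 g -> has_sum f s -> has_sum g s.
Proof. by move=> /funext ->. Qed.

Lemma has_sum0 : has_sum (fun=> 0) 0.
Proof.
by apply/has_sumP => e e0; exists fset0 => S _; rewrite big1// subr0 v0.
Qed.

Lemma has_sumD f g s t :
  has_sum f s -> has_sum g t -> has_sum (fun x => f x + g x) (s + t).
Proof.
move=> /has_sumP fs /has_sumP gt; apply/has_sumP => e e0.
have [S hS] := fs e e0; have [T hT] := gt e e0.
exists (S `|` T)%fset => U; rewrite fsubUset => /andP[SU TU].
by rewrite big_split opprD addrACA; apply: v_add_lt; [apply: hS|apply: hT].
Qed.

Lemma has_sumZ (c : valued v) f s : has_sum f s -> has_sum (fun x => c * f x) (c * s).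
Proof.
have [->|c0] := eqVneq c 0.
  move=> _; rewrite mul0r; apply: eq_has_sum has_sum0 => x.
  by rewrite mul0r.
move=> /has_sumP fs; apply/has_sumP => e e0.
have vc : 0 < v c by rewrite vgt0.
have [|S hS] := fs (e / v c); first by rewrite divr_gt0.
exists S => T /hS; rewrite -big_distrr /= -mulrBr vM ltr_pdivlMr//.
by rewrite mulrC.
Qed.

Lemma has_sum_sum (I : finType) (P : pred I) (f : I -> X -> valued v) (s : I -> valued v) :
  (forall j, P j -> has_sum (f j) (s j)) ->
  has_sum (fun x => \sum_(j | P j) f j x) (\sum_(j | P j) s j).
Proof.
move=> fs; rewrite [X in has_sum X _](_ : _ = \sum_(j | P j) f j); last first.
  by apply/funext => x; rewrite fct_sumE.
elim/big_ind2 : _ => //; first exact: has_sum0.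
by move=> *; apply: has_sumD.
Qed.

Lemma has_sum_delta (x0 : X) (c : valued v) :
  has_sum (fun x => if x == x0 then c else 0) c.
Proof.
apply/has_sumP => e e0; exists [fset x0]%fset => S; rewrite fsub1set => xS.
rewrite (big_fsetD1 x0)//= eqxx big1_fset ?addr0 ?subrr ?v0//.
by move=> x; rewrite !inE => /andP[/negbTE -> _].
Qed.

End Sums.

Lemma has_sum_reindex (R : realType) (C : fieldType) (v : nonarch_absval R C)
    (X Y : choiceType) (h : X -> Y) (h' : Y -> X) (f : Y -> valued v) s :
  cancel h h' -> cancel h' h -> has_sum f s -> has_sum (f \o h) s.
Proof.
move=> hK h'K /has_sumP fs; apply/has_sumP => e /fs[S hS].
exists (h' @` S)%fset => T ST.
have := hS (h @` T)%fset; rewrite big_imfset /=; last first.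
  by move=> x y _ _; apply: (can_inj hK).
apply; apply/fsubsetP => y yS; rewrite -(h'K y) in_imfset//=.
by apply: (fsubsetP ST); rewrite in_imfset.
Qed.

(** * Partial fractions over a finite subgroup *)

Section FiniteSubgroup.
Context {C : fieldType}.
Variables (W : seq C) (W_uniq : uniq W) (W0 : 0 \in W).
Hypothesis W_sub : forall x y, x \in W -> y \in W -> x - y \in W.

Let W_opp x : x \in W -> - x \in W.
Proof. by move=> xW; rewrite -sub0r W_sub. Qed.

Let W_add x y : x \in W -> y \in W -> x + y \in W.
Proof. by move=> xW yW; rewrite -[y]opprK W_sub// W_opp. Qed.

Lemma subgroup_reindex {Z : Type} {idx : Z} {op : SemiGroup.com_law Z}
    {h : C -> C} {P : pred C} {f : C -> Z} :
  {in W, forall x, h x \in W} -> injective h ->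
  \big[op/idx]_(x <- W | P (h x)) f (h x) = \big[op/idx]_(x <- W | P x) f x.
Proof.
move=> hW h_inj; rewrite -(big_map h P f); apply: perm_big.
have hU : uniq (map h W) by rewrite map_inj_uniq.
apply: uniq_perm => //; apply: (uniq_min_size hU _ _).2; last by rewrite size_map.
by move=> _ /mapP[x xW ->]; apply: hW.
Qed.

Local Notation S z := (\sum_(x <- W) (z + x)^-1).

Let W_neq0 z x : z \notin W -> x \in W -> z + x != 0.
Proof.
by move=> zW xW; apply: contraNneq zW => /eqP; rewrite addr_eq0 => /eqP ->; apply: W_opp.
Qed.

(** Partial fractions: summing
    1/((z+x)(w+y)) = (1/(z+x) + 1/(w+y)) / (z+w+x+y) over x + y = t first.
    This says that 1/S is additive. *)
Lemma subgroup_sum_inv_mul z w : z \notin W -> w \notin W -> z + w \notin W ->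
  S z * S w = S (z + w) * (S z + S w).
Proof.
move=> zW wW zwW.
transitivity (\sum_(x <- W) \sum_(t <- W)
    (z + w + t)^-1 * ((z + x)^-1 + (w + (t - x))^-1)).
  rewrite big_distrlr /= big_seq [RHS]big_seq; apply: eq_bigr => x xW.
  rewrite -[RHS](subgroup_reindex (h := +%R x)); last exact: addrI.
    rewrite big_seq [RHS]big_seq; apply: eq_bigr => y yW.
    rewrite [x + y]addrC addrK; field.
    by rewrite W_neq0 ?W_neq0 // W_add.
  by move=> y; apply: W_add.
rewrite exchange_big /= mulr_suml; rewrite big_seq [RHS]big_seq.
apply: eq_bigr => t tW; rewrite -big_distrr /=; congr (_ * _).
rewrite big_split /=; congr (_ + _).
rewrite -[RHS](subgroup_reindex (h := fun x => t - x)) //; first by move=> x; apply: W_sub.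
by move=> x y /addrI /oppr_inj.
Qed.

(** The numerator of the partial fraction sum is a polynomial in [z] of degree
    less than [size W] taking the same value at all points of [W]: it is
    constant. *)
Lemma subgroup_sum_inv_prod z : z \notin W ->
  S z * \prod_(x <- W) (z + x) = \prod_(x <- W | x != 0) x.
Proof.
move=> zW; pose c := \prod_(x <- W | x != 0) x.
pose p : {poly C} := \sum_(x <- W) \prod_(y <- W | y != x) ('X - y%:P).
have pE a : p.[a] = \sum_(x <- W) \prod_(y <- W | y != x) (a - y).
  rewrite /p horner_sum; apply: eq_bigr => x _.
  by rewrite horner_prod; apply: eq_bigr => y _; rewrite hornerXsubC.
have p_root a : a \in W -> p.[a] = c.
  move=> aW; rewrite pE (big_rem a)//= [X in _ + X]big1_seq ?addr0.
    rewrite /c -[RHS](subgroup_reindex (h := fun x => a - x)) /=; last first.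
    - by move=> x y /addrI /oppr_inj.
    - by move=> x; apply: W_sub.
    by apply: eq_bigl => x; rewrite subr_eq0 eq_sym.
  move=> x /andP[_]; rewrite mem_rem_uniq// inE => /andP[xa xW].
  by rewrite (big_rem a)//= eq_sym xa subrr mul0r.
have size_p : (size p <= size W)%N.
  rewrite /p big_seq; apply: (leq_trans (size_sum _ _ _)).
  apply/bigmax_leqP_seq => x xW _.
  rewrite -big_filter size_prod_XsubC -rem_filter// size_rem// prednK//.
  by case: W xW.
have pc : p = c%:P.
  apply/eqP; rewrite -subr_eq0; apply: contraT => q0.
  have := max_poly_roots q0 (rs := W) _ W_uniq; rewrite ltnNge.
  have -> : (size (p - c%:P)%R <= size W)%N.
    apply: leq_trans (size_polyD _ _) _; rewrite geq_max size_p size_polyN.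
    by apply: leq_trans (size_polyC_leq1 _) _; case: W W0.
  move=> h; suff : ~~ true by [].
  apply: h; apply/allP => a aW.
  by rewrite /root hornerD hornerN hornerC p_root// subrr.
have -> : S z = \sum_(x <- W) (z - x)^-1.
  rewrite -[RHS](subgroup_reindex W_opp oppr_inj).
  by apply: eq_bigr => x _; rewrite opprK.
have -> : \prod_(x <- W) (z + x) = \prod_(x <- W) (z - x).
  rewrite -[RHS](subgroup_reindex W_opp oppr_inj).
  by apply: eq_bigr => x _; rewrite opprK.
transitivity (p.[z]); last by rewrite pc hornerC.
rewrite pE mulr_suml big_seq [RHS]big_seq; apply: eq_bigr => x xW.
rewrite (big_rem x)//= mulKf ?W_neq0 ?W_opp//.
by rewrite rem_filter// big_filter.
Qed.

End FiniteSubgroup.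

(** * Reciprocal sums over a discrete subgroup *)

Section DiscreteSubgroup.
Context {R : realType} {C : fieldType} {v : nonarch_absval R C}.
Hypothesis complete : forall G : set_system (valued v),
  ProperFilter G -> cauchy G -> cvg G.
Context {X : zmodType} {i : {additive X -> valued v}}.
Hypothesis i_inj : injective i.
Variable L : set X.
Hypothesis L0 : L 0.
Hypothesis L_sub : forall x y, L x -> L y -> L (x - y).
Hypothesis L_fin : forall B : R, finite_set [set x | L x /\ v (i x) <= B].

(** This is [1 / e], where [e] is the exponential function of the lattice
    [i @` L]: it is the logarithmic derivative of [e], whose derivative is [1].
    Working with the sum avoids infinite products. *)
Definition invsum (z : valued v) : valued v :=
  lim ((fun S : {fset X} => \sum_(x <- S) if x \in L then (z + i x)^-1 else 0)
         @ totally).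

Let L_opp x : L x -> L (- x).
Proof. by move=> xL; rewrite -sub0r; apply: L_sub. Qed.

Lemma has_sum_invsum z :
  has_sum (fun x => if x \in L then (z + i x)^-1 else 0) (invsum z).
Proof.
suff [s fs] : exists s, has_sum (fun x => if x \in L then (z + i x)^-1 else 0) s.
  by rewrite /invsum (lim_has_sum fs).
apply: summable_of_finite => // e e0.
apply: sub_finite_set (L_fin (e^-1 + v z)) => x /=.
case: ifPn => [|_]; last by rewrite v0 leNgt e0.
rewrite inE => xL ex; split => //.
have : v (z + i x) <= e^-1.
  have [->|zx] := eqVneq (z + i x) 0; first by rewrite v0 invr_ge0 ltW.
  by rewrite -[v _]invrK lef_pV2 ?posrE ?invr_gt0 ?vgt0// -vV.
move=> zx; rewrite -[i x](addrK z) [i x + z]addrC; apply: v_sub_le.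
  by apply: le_trans zx _; rewrite lerDl vge0.
by rewrite lerDr invr_ge0 ltW.
Qed.

Lemma has_sum_inv_coset (A : set X) (c : X) z :
  (forall x, A x <-> L (x - c)) ->
  has_sum (fun x => if x \in A then (z + i x)^-1 else 0) (invsum (z + i c)).
Proof.
move=> AL; have := has_sum_reindex (subrK c) (addrK c) (has_sum_invsum (z := z + i c)).
apply: eq_has_sum => x /=; rewrite raddfB -addrA [i c + _]addrC subrK.
by have -> : (x - c \in L) = (x \in A) by apply/idP/idP; rewrite !inE => /AL.
Qed.

Lemma invsumN z : invsum (- z) = - invsum z.
Proof.
rewrite -[RHS]mulN1r; apply: (has_sum_unique (has_sum_invsum (z := - z))).
have := has_sum_reindex (@opprK X) (@opprK X) (has_sumZ (c := - 1) (has_sum_invsum (z := z))).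
apply: eq_has_sum => x /=.
have -> : (- x \in L) = (x \in L).
  by apply/idP/idP; rewrite !inE => /L_opp; rewrite ?opprK.
by case: ifP => _; rewrite ?mulr0// raddfN mulN1r -invrN opprB addrC.
Qed.

Local Notation D := (i @` L).

Let D_shift z x : ~ D z -> L x -> z + i x != 0.
Proof.
move=> zD xL; apply/eqP => /eqP; rewrite addr_eq0 => /eqP zx; apply: zD.
by exists (- x); [apply: L_opp|rewrite raddfN zx].
Qed.

Local Notation W B := (fset_set [set x | L x /\ v (i x) <= B]).

Let inW B x : (x \in W B) <-> (L x /\ v (i x) <= B).
Proof. by rewrite in_fset_set// inE. Qed.

(** A lattice point larger than both [B] and [z] contributes at most [B^-1]. *)
Lemma invsum_approx B z : 0 < B -> v z <= B ->
  v (invsum z - \sum_(x <- W B) (z + i x)^-1) <= B^-1.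
Proof.
move=> B0 zB.
have -> : \sum_(x <- W B) (z + i x)^-1
    = \sum_(x <- W B) if x \in L then (z + i x)^-1 else 0.
  rewrite big_seq [RHS]big_seq; apply: eq_bigr => x /inW[xL _].
  by rewrite mem_set.
apply: has_sum_dominated (has_sum_invsum (z := z)); first by rewrite invr_ge0 ltW.
move=> x xW; case: ifPn => [|_]; last by rewrite v0 invr_ge0 ltW.
rewrite inE => xL; have xB : B < v (i x).
  by rewrite ltNge; apply: contra xW => xB; apply/inW.
by rewrite addrC vV v_dom ?lef_pV2 ?posrE ?(lt_trans B0 xB)// ?ltW// (le_lt_trans zB).
Qed.

Let imW B := [seq i x | x <- W B].

Let imW_uniq B : uniq (imW B).
Proof. by rewrite map_inj_uniq ?fset_uniq. Qed.

Let imW0 B : 0 <= B -> 0 \in imW B.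
Proof.
by move=> B0; apply/mapP; exists 0; rewrite ?raddf0//; apply/inW; rewrite raddf0 v0.
Qed.

Let imW_sub B x y : x \in imW B -> y \in imW B -> x - y \in imW B.
Proof.
move=> /mapP[a /inW[aL aB] ->] /mapP[b /inW[bL bB] ->].
rewrite -raddfB map_f//; apply/inW; split; first exact: L_sub.
by rewrite raddfB; apply: v_sub_le.
Qed.

Let imW_notin B z : ~ D z -> z \notin imW B.
Proof. by move=> zD; apply/negP => /mapP[x /inW[xL _] zx]; apply: zD; exists x. Qed.

(** The reciprocal of [invsum] is additive: pass to the limit in the identity
    for the finite groups of lattice points of bounded size. *)
Lemma invsum_mul z w : ~ D z -> ~ D w -> ~ D (z + w) ->
  invsum z * invsum w = invsum (z + w) * (invsum z + invsum w).
Proof.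
move=> zD wD zwD; apply/eqP; rewrite -subr_eq0 -veq0.
set a := invsum z; set b := invsum w; set c := invsum (z + w).
pose M := v a + v b + v c + 1.
have [aM bM cM oM] : [/\ v a + 1 <= M, v b + 1 <= M, v c + 1 <= M & 1 <= M].
  by rewrite /M; have := vge0 a; have := vge0 b; have := vge0 c; split; lra.
suff bound B : 0 < B -> v z + v w + 1 <= B ->
    v (a * b - c * (a + b)) <= M / B.
  apply: contraT; rewrite veq0 -vgt0 => pos.
  (* For this [B] the bound [M / B] is less than the difference itself. *)
  pose B := v z + v w + 1 + 2 * M / v (a * b - c * (a + b)).
  have q0 : 0 <= 2 * M / v (a * b - c * (a + b)).
    by rewrite !mulr_ge0 ?invr_ge0 ?vge0//; lra.
  have zw0 : 0 <= v z + v w by rewrite addr_ge0 ?vge0.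
  have B0 : 0 < B by rewrite /B; lra.
  have := bound B B0; rewrite lerDl q0 => /(_ isT).
  rewrite ler_pdivlMr// mulrC -ler_pdivlMr//.
  by rewrite /B; set q := M / _; rewrite -mulrA -/q in q0 *; lra.
move=> B0 zwB.
have [vz vw vzw] : [/\ v z <= B, v w <= B & v (z + w) <= B].
  have := vge0 z; have := vge0 w => ? ?.
  by have [] : v z <= B /\ v w <= B by [split; lra]; split => //; apply: v_add_le.
have B1 : B^-1 <= 1 by rewrite invf_le1//; have := vge0 z; have := vge0 w; lra.
have Bi : 0 <= B^-1 by rewrite invr_ge0 ltW.
pose S y := \sum_(x <- imW B) (y + x)^-1.
have ap y : v y <= B -> v (invsum y - S y) <= B^-1.
  by move=> yB; rewrite /S big_map; apply: invsum_approx.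
have fin : S z * S w = S (z + w) * (S z + S w).
  apply: (subgroup_sum_inv_mul (imW_uniq B) (imW0 (ltW B0)) (@imW_sub B));
  exact: imW_notin.
have SM y : v (invsum y) + 1 <= M -> v y <= B -> v (S y) <= M.
  move=> yM yB; rewrite -[S y](subKr (invsum y)).
  have := ap y yB; have := vge0 (invsum y) => ? ?.
  by apply: v_sub_le; lra.
have -> : a * b - c * (a + b) = (a - S z) * b + S z * (b - S w)
    - (c - S (z + w)) * (a + b) - S (z + w) * ((a - S z) + (b - S w)).
  have -> : S z * (b - S w) = S z * b - S (z + w) * (S z + S w).
    by rewrite mulrBr fin.
  by ring.
have M0 : 0 <= M by lra.
have [av bv] : v a <= M /\ v b <= M by split; lra.
have small x y : v x <= M -> v y <= B^-1 -> v (x * y) <= M / B.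
  by move=> xM yB; rewrite vM; apply: ler_pM; rewrite ?vge0.
apply: v_sub_le; first (apply: v_sub_le; first apply: v_add_le).
- by rewrite mulrC; apply: small => //; apply: ap.
- by apply: small; [apply: SM|apply: ap].
- by rewrite mulrC; apply: small; [apply: v_add_le|apply: ap].
- by apply: small; [apply: SM|apply: v_add_le; apply: ap].
Qed.

(** By the product formula for finite groups, lattice points larger than [z]
    do not change the size of the sum; its limit cannot be zero. *)
Lemma invsum_neq0 z : ~ D z -> invsum z != 0.
Proof.
move=> zD; pose S B := \sum_(x <- W B) (z + i x)^-1.
pose P B := \prod_(x <- W B) (z + i x).
pose Q B := \prod_(x <- W B | i x != 0) i x.
have SPQ B : 0 <= B -> S B * P B = Q B.
  move=> B0.
  have := subgroup_sum_inv_prod (imW_uniq B) (imW0 B0) (@imW_sub B) (imW_notin B zD).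
  by rewrite !big_map.
have P0 B : P B != 0.
  by rewrite prodf_seq_neq0; apply/allP => x /inW[xL _]; apply: D_shift.
have Q0 B : Q B != 0 by rewrite prodf_seq_neq0; apply/allP => x _; apply/implyP.
pose B0 := v z; have B0_ge0 : 0 <= B0 by exact: vge0.
have sub B : B0 <= B -> [fset x in W B | x \in W B0]%fset = W B0.
  move=> BB; apply/fsetP => x; rewrite !inE /= andb_idl//.
  by move=> /inW[xL xB]; apply/inW; split=> //; apply: le_trans BB.
have stable B : B0 <= B -> v (S B) = v (S B0).
  move=> BB; have B_ge0 : 0 <= B by apply: le_trans BB.
  have SE b : 0 <= b -> v (S b) = v (Q b) / v (P b).
    by move=> b0; rewrite -(SPQ b b0) vM mulfK// veq0.
  rewrite !SE// /Q /P (big_fsetIDcond _ (mem (W B0))) /= sub//.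
  rewrite [X in _ / v X](big_fsetID _ (mem (W B0))) /= sub// -/(Q B0) -/(P B0).
  rewrite !vM invfM mulrACA.
  set q := \prod_(x <- _ | _) _; set p := \prod_(x <- _) _.
  suff -> : v q = v p.
    have p0 : v p != 0.
      rewrite veq0 prodf_seq_neq0; apply/allP => x; rewrite !inE /=.
      by case/andP => /inW[xL _] _; apply: D_shift.
    by rewrite mulfV// mulr1.
  rewrite /q /p !v_prod big_seq_cond [RHS]big_seq; apply: eq_big => x.
    rewrite !inE /=; apply: andb_idr => /andP[/inW[xL xB] xB0].
    apply: contraNneq xB0 => x0; apply/inW; split=> //.
    by rewrite x0 v0.
  rewrite !inE /= => /andP[/andP[/inW[xL xB] xB0] _].
  rewrite addrC v_dom// ltNge; apply: contra xB0 => ?; exact/inW.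
have S0 : 0 < v (S B0).
  rewrite vgt0; apply: contra (Q0 B0) => /eqP s0.
  by rewrite -SPQ// s0 mul0r.
apply/eqP => inv0.
pose B := B0 + 1 + 2 / v (S B0).
have q0 : 0 < 2 / v (S B0) by rewrite divr_gt0.
have BB : B0 <= B by rewrite /B; lra.
have Bgt0 : 0 < B by rewrite /B; lra.
have := invsum_approx Bgt0 BB; rewrite inv0 sub0r vN -/(S B) stable//.
rewrite -[B^-1]mul1r ler_pdivlMr// mulrC -ler_pdivlMr//.
by rewrite /B; rewrite [2 / _](_ : _ = 2 * (1 / v (S B0))) in q0 *;
  [set t := 1 / _; rewrite -/t in q0; lra | rewrite mul1r].
Qed.

Lemma image_opp z : D z -> D (- z).
Proof. by move=> [x xL <-]; exists (- x); [apply: L_opp|rewrite raddfN]. Qed.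

(** If [z - w] were not in the lattice, additivity of the reciprocal would give
    [invsum z * invsum (- w) = 0]. *)
Lemma invsum_inj z w : ~ D z -> ~ D w -> invsum z = invsum w -> D (z - w).
Proof.
move=> zD wD zw; apply: contrapT => zwD.
have wD' : ~ D (- w) by move=> /image_opp; rewrite opprK.
have := invsum_mul zD wD' zwD.
rewrite invsumN zw subrr mulr0 mulrN => /eqP.
by rewrite oppr_eq0 mulf_eq0 orbb; apply/negP/invsum_neq0.
Qed.

(** The nonzero lattice points are bounded away from [0], by [b^-1]. *)
Lemma invsum_pole : exists2 b : R, 0 < b & forall z : valued v, z != 0 -> v z * b < 1 ->
  ~ D z /\ v (invsum z - z^-1) <= b.
Proof.
pose S := [fset x in W 1 | x != 0]%fset.
pose b := 1 + \sum_(x <- S) (v (i x))^-1.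
have b1 : 1 <= b.
  by rewrite lerDl; apply: sumr_ge0 => x _; rewrite invr_ge0 vge0.
have big x : L x -> x != 0 -> b^-1 <= v (i x).
  move=> xL x0; have [x1|x1] := leP (v (i x)) 1; last first.
    by apply: le_trans (ltW x1); rewrite invf_le1//; lra.
  have ix : 0 < v (i x) by rewrite vgt0 -(raddf0 i) (inj_eq i_inj).
  have xS : x \in S by rewrite !inE /= x0 andbT; apply/inW.
  rewrite -[leRHS]invrK lef_pV2 ?posrE ?invr_gt0//; last by lra.
  rewrite /b (big_fsetD1 x)//= addrCA lerDl addr_ge0// sumr_ge0// => y _.
  by rewrite invr_ge0 vge0.
exists b; first by lra.
move=> z z0 zb; have b0 : 0 < b by lra.
have zb' : v z < b^-1 by rewrite -[ltRHS]mul1r ltr_pdivlMr.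
have zD : ~ D z.
  move=> [x xL xz]; have x0 : x != 0 by apply: contraNneq z0 => x0; rewrite -xz x0 raddf0.
  by have := big x xL x0; rewrite xz leNgt zb'.
split=> //.
have := has_sumD (has_sum_invsum (z := z)) (has_sum_delta 0 (c := - z^-1)).
apply: has_sum_le => [|x]; first exact: ltW.
have [->|x0] := eqVneq x 0.
  by rewrite mem_set// raddf0 addr0 subrr v0 ltW.
rewrite addr0; case: ifPn => [|_]; last by rewrite v0 ltW.
rewrite inE => xL; have := big x xL x0 => xb.
rewrite addrC vV v_dom ?(lt_le_trans zb')//.
by rewrite -[leRHS]invrK lef_pV2// posrE ?invr_gt0//; apply: lt_le_trans xb; rewrite invr_gt0.
Qed.

End DiscreteSubgroup.

(** * Torsion classes *)

Section TorsionClasses.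
Context {R : realType} {C : fieldType} {v : nonarch_absval R C}.
Hypothesis complete : forall G : set_system (valued v),
  ProperFilter G -> cauchy G -> cvg G.
Variables (n : valued v) (I : finType) (t0 : I).
Hypothesis n_gt1 : 1 < v n.

(** What the argument uses of [N^-1 L_U / L_U], where [L] is the lattice, [T t]
    the part of the torsion class [t] lying in the space, and [scale] the
    multiplication by [N]. A class may well be empty. *)
Record torsion_classes (X : zmodType) (i : {additive X -> valued v}) (L : set X)
    (scale : X -> X) (T : I -> set X) : Prop := TorsionClasses {
  cls_inj : injective i;
  cls_lat0 : L 0;
  cls_latB : forall x y, L x -> L y -> L (x - y);
  cls_fin : forall B : R, finite_set [set x | L x /\ v (i x) <= B];
  cls_bij : bijective scale;
  cls_scale : forall x, i (scale x) = n * i x;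
  cls_coset : forall t c, T t c -> forall x, T t x <-> L (x - c);
  cls_t0 : forall x, T t0 x <-> L x;
  cls_unique : forall t t' x, T t x -> T t' x -> t = t';
  cls_cover : forall x, L (scale x) <-> exists t, T t x
}.

Section OneSystem.
Context {X : zmodType} {i : {additive X -> valued v}} {L : set X}.
Context {scale : X -> X} {T : I -> set X}.
Hypothesis S : torsion_classes i L scale T.

Let i_inj := cls_inj S.
Let L0 := cls_lat0 S.
Let L_sub := cls_latB S.
Let L_fin := cls_fin S.
Let i_scale := cls_scale S.
Let T_coset := cls_coset S.
Let T_t0 := cls_t0 S.
Let T_unique := cls_unique S.
Let T_cover := cls_cover S.

Local Notation D := (i @` L).
Local Notation G := (@invsum R C v X i L).

Let n0 : n != 0. Proof. by rewrite -vgt0 (lt_trans ltr01). Qed.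

Let class_sum z t c : T t c ->
  has_sum (fun x => if x \in T t then (z + i x)^-1 else 0) (G (z + i c)).
Proof. by move=> ct; exact: (has_sum_inv_coset complete L_fin (T_coset ct)). Qed.

Lemma class_summable t :
  exists s, has_sum (fun x => if x \in T t then (i x)^-1 else 0) s.
Proof.
have [[c ct]|no] := pselect (exists c, T t c); last first.
  exists 0; apply: eq_has_sum has_sum0 => x; rewrite memNset// => xt.
  by apply: no; exists x.
exists (G (0 + i c)); apply: eq_has_sum (class_sum (z := 0) ct) => x.
by rewrite add0r.
Qed.

Variable E : I -> valued v.
Hypothesis E_t0 : E t0 = 0.
Hypothesis E_sum : forall t, t != t0 ->
  has_sum (fun x => if x \in T t then (i x)^-1 else 0) (E t).

Lemma class_value t c : t != t0 -> T t c -> E t = G (i c).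
Proof.
move=> tt0 ct; apply: has_sum_unique (E_sum tt0) _.
have := class_sum (z := 0) ct; rewrite add0r.
by apply: eq_has_sum => x; rewrite add0r.
Qed.

Lemma class_notin t c : t != t0 -> T t c -> ~ D (i c).
Proof.
move=> /eqP tt0 ct [x xL /i_inj xc]; apply: tt0.
by apply: (T_unique ct); apply/T_t0; rewrite -xc.
Qed.

Let class_value0 t : t != t0 -> (forall x, ~ T t x) -> E t = 0.
Proof.
move=> tt0 no; apply: has_sum_unique (E_sum tt0) _.
by apply: eq_has_sum has_sum0 => x; rewrite memNset.
Qed.

Lemma class_neq0 t : E t != 0 -> t != t0 /\ exists2 c, T t c & E t = G (i c).
Proof.
have [->|tt0] := eqVneq t t0; first by rewrite E_t0 eqxx.
move=> /eqP e; split=> //; apply: contrapT => no; apply: e.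
by apply: class_value0 => // x xt; apply: no; exists x => //; apply: class_value.
Qed.

Let L_scale x : L x -> L (scale x).
Proof. by move=> /T_t0 xT; apply/T_cover; exists t0. Qed.

Let D_sub z z' : D z -> D z' -> D (z - z').
Proof.
by move=> [x xL <-] [y yL <-]; exists (x - y); [apply: L_sub|rewrite raddfB].
Qed.

Let D_add z z' : D z -> D z' -> D (z + z').
Proof.
move=> zD z'D; rewrite -[z']opprK; apply: D_sub => //.
exact: (image_opp L0 L_sub).
Qed.

Let D_scale z : D z -> D (n * z).
Proof. by move=> [x xL <-]; exists (scale x); [apply: L_scale|rewrite i_scale]. Qed.

Let D_scale_class t c : T t c -> D (n * i c).
Proof. by move=> ct; exists (scale c); [apply/T_cover; exists t|rewrite i_scale]. Qed.

Let G_neq0 z : ~ D z -> G z != 0.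
Proof. exact: invsum_neq0. Qed.

(** The class of [c] contributes [G (z + i c)], which additivity of [1 / G]
    expresses through [G z] and [E t = G (i c)]; an empty class contributes [0],
    in accordance with [E t = 0]. *)
Let class_term z t : ~ D (n * z) ->
  has_sum (fun x => if x \in T t then (z + i x)^-1 else 0)
    (if t == t0 then G z else G z * E t / (G z + E t)).
Proof.
move=> nzD; have zD : ~ D z by move/D_scale.
have [->|tt0] := eqVneq t t0.
  have ct : T t0 0 by apply/T_t0.
  by have := class_sum (z := z) ct; rewrite raddf0 addr0.
have [[c ct]|no] := pselect (exists c, T t c); last first.
  rewrite class_value0 ?mulr0 ?mul0r//; last by move=> x xt; apply: no; exists x.
  apply: eq_has_sum has_sum0 => x; rewrite memNset// => xt.
  by apply: no; exists x.
have cD := class_notin tt0 ct.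
have zcD : ~ D (z + i c).
  move=> /D_scale; rewrite mulrDr => zc; apply: nzD.
  rewrite -[n * z](addrK (n * i c)); apply: D_sub => //.
  exact: D_scale_class ct.
have Ec := class_value tt0 ct.
have := invsum_mul complete i_inj L0 L_sub L_fin zD cD zcD; rewrite -Ec => mul.
have s0 : G z + E t != 0.
  apply/eqP => s0; move: mul; rewrite s0 mulr0 => /eqP.
  by rewrite mulf_eq0 Ec (negbTE (G_neq0 zD)) (negbTE (G_neq0 cD)).
have -> : G z * E t / (G z + E t) = G (z + i c) by rewrite mul mulfK.
exact: class_sum.
Qed.

Lemma class_torsion_system : torsion_system n E D G.
Proof.
have [unscale scaleK unscaleK] := cls_bij S.
split.
- by exists 0 => //; rewrite raddf0.
- exact: D_scale.
- exact: G_neq0.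
- move=> z zD; have Gz := G_neq0 zD; split.
    move=> [x xL xz]; pose c := unscale x.
    have ic : i c = z by apply: (mulfI n0); rewrite -i_scale unscaleK.
    have [t ct] : exists t, T t c by apply/T_cover; rewrite unscaleK.
    have tt0 : t != t0.
      by apply/eqP => tt0; apply: zD; exists c => //; apply/T_t0; rewrite -tt0.
    by exists t; rewrite (class_value tt0 ct) ic.
  move=> [t Et]; have : E t != 0 by rewrite Et.
  move=> /class_neq0[tt0 [c ct Ec]].
  have cD := class_notin tt0 ct.
  have : G z = G (i c) by rewrite -Et.
  move=> /(invsum_inj complete i_inj L0 L_sub L_fin zD cD) zc.
  rewrite -(subrK (i c) z) mulrDr; apply: D_add; first exact: D_scale.
  exact: D_scale_class ct.
- move=> z nzD.
  (* Both sides sum [1 / (z + i x)] over the [x] that [scale] sends into [L]. *)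
  have lhs := has_sumZ (c := n) (has_sum_reindex scaleK unscaleK
                 (has_sum_invsum complete L_fin (z := n * z))).
  have rhs := has_sum_sum (P := xpredT) (fun t _ => class_term (t := t) nzD).
  rewrite [RHS](_ : _ = \sum_t if t == t0 then G z else
      G z * E t / (G z + E t)); last first.
    rewrite [RHS](bigD1 t0)//= eqxx [in LHS](bigD1 t0)//= E_t0.
    rewrite mulr0 mul0r add0r; congr (_ + _); apply: eq_bigr => t /negbTE tt0.
    by rewrite tt0.
  apply: (has_sum_unique lhs); apply: eq_has_sum rhs => x /=.
  have [xL|xL] := pselect (L (scale x)).
    have [t xt] := (T_cover x).1 xL.
    rewrite mem_set// (bigD1 t)//= mem_set// big1 ?addr0; last first.
      move=> t' /eqP t't; rewrite memNset// => xt'.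
      by apply: t't; apply: T_unique xt' xt.
    by rewrite i_scale -mulrDr invfM mulrA mulfV// mul1r.
  rewrite memNset// mulr0 big1// => t _; rewrite memNset// => xt.
  by apply: xL; apply/T_cover; exists t.
- exact: invsum_pole.
Qed.

End OneSystem.

(** The reciprocal sums over the nonzero classes determine the lattice and then,
    [invsum] being injective modulo the lattice, the position of each class. *)
Lemma classes_match (X X' : zmodType) (i : {additive X -> valued v})
    (i' : {additive X' -> valued v}) L L' scale scale' T T' (E : I -> valued v) :
  torsion_classes i L scale T -> torsion_classes i' L' scale' T' ->
  E t0 = 0 ->
  (forall t, t != t0 -> has_sum (fun x => if x \in T t then (i x)^-1 else 0) (E t)) ->
  (forall t, t != t0 -> has_sum (fun x => if x \in T' t then (i' x)^-1 else 0) (E t)) ->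
  forall t c, T t c -> exists2 c', T' t c' & i' c' = i c.
Proof.
move=> S S' E0 Es Es' t c ct.
have sys := class_torsion_system S E0 Es; have sys' := class_torsion_system S' E0 Es'.
have [DD' GG'] := torsion_system_unique n_gt1 sys sys'.
have [tt0|tt0] := eqVneq t t0.
  have : (i @` L) (i c) by exists c => //; apply/(cls_t0 S); rewrite -tt0.
  by rewrite DD' => -[c' c'L ic']; exists c' => //; rewrite tt0; apply/(cls_t0 S').
have cD := class_notin S tt0 ct.
have Ec := class_value S Es tt0 ct.
have : E t != 0 by rewrite Ec; apply: ts_neq0 sys _ cD.
move=> /(class_neq0 S' E0 Es')[_ [c1 c1t Ec1]].
have c1D : ~ (i @` L) (i' c1) by rewrite DD'; exact: (class_notin S' tt0 c1t).
have : (i @` L) (i c - i' c1).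
  apply: (invsum_inj complete (cls_inj S) (cls_lat0 S) (cls_latB S) (cls_fin S)) => //.
  by rewrite -Ec (GG' _ c1D).
rewrite DD' => -[l lL il]; exists (l + c1).
  by apply/(cls_coset S' c1t); rewrite addrK.
by rewrite raddfD il subrK.
Qed.

End TorsionClasses.

(** * Representatives of the torsion classes *)

Section Lattices.
Context {F : finFieldType} {r : nat}.
Local Notation A := {poly F}.
Local Notation K := {fraction {poly F}}.
Local Notation V := 'rV[{fraction {poly F}}]_r.
Local Notation lat := (@Alattice F r).
Implicit Types x y : V.

Lemma lat0 : lat 0.
Proof. by exists 0; rewrite // map_mx0. Qed.

Lemma latB x y : lat x -> lat y -> lat (x - y).
Proof. by move=> [a _ <-] [b _ <-]; exists (a - b); rewrite // map_mxB. Qed.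

Lemma latN x : lat x -> lat (- x).
Proof. by move=> xL; rewrite -sub0r; apply: latB => //; apply: lat0. Qed.

Lemma latD x y : lat x -> lat y -> lat (x + y).
Proof. by move=> xL yL; rewrite -[y]opprK; apply: latB => //; apply: latN. Qed.

Lemma lat_map (b : 'rV[A]_r) : lat (map_mx (@tofrac A) b).
Proof. by exists b. Qed.

Lemma latZ (a : A) x : lat x -> lat (tofrac a *: x).
Proof. by move=> [b _ <-]; exists (a *: b); rewrite // map_mxZ. Qed.

Variables (N : A) (d : nat).
Hypothesis size_N : size N = d.+1.

Let N0 : N != 0. Proof. by rewrite -size_poly_eq0 size_N. Qed.
Let tN0 : (tofrac N : K) != 0. Proof. by rewrite tofrac_eq0. Qed.

(** The rows of [t] are the coefficients of the numerators of a representative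
    [a / N] of a class of [(N^-1 A / A)^r], the [a] being reduced modulo [N]. *)
Definition torsion_num (t : 'M[F]_(r, d)) : 'rV[A]_r := \row_j rVpoly (row j t).

Definition torsion_vec (t : 'M[F]_(r, d)) : V :=
  (tofrac N)^-1 *: map_mx (@tofrac A) (torsion_num t).

Definition torsion_class (t : 'M[F]_(r, d)) : set V :=
  [set y | lat (y - torsion_vec t)].

Lemma torsion_vecB t t' : torsion_vec (t - t') = torsion_vec t - torsion_vec t'.
Proof.
rewrite /torsion_vec -scalerBr -map_mxB; congr (_ *: map_mx _ _).
by apply/rowP => j; rewrite !mxE !linearB.
Qed.

Lemma torsion_vec0 : torsion_vec 0 = 0.
Proof. by rewrite -(subrr 0) torsion_vecB subrr. Qed.

(** The numerators have degree less than [d]: none but [0] is divisible by [N]. *)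
Lemma torsion_vec_lat t : lat (torsion_vec t) -> t = 0.
Proof.
move=> [a _ /(congr1 (GRing.scale (tofrac N)))].
rewrite /torsion_vec scalerA mulfV// scale1r -map_mxZ => e.
apply/row_matrixP => j; rewrite row0; apply: (can_inj rVpolyK); rewrite raddf0.
have /eqP := congr1 (fun M : V => M 0 j) e; rewrite !mxE tofrac_eq => /eqP ej.
have [a0|a0] := eqVneq (a 0 j) 0; first by rewrite -ej a0 mulr0.
have : (size (rVpoly (row j t)) <= d)%N by apply: size_poly.
rewrite -ej size_mul// size_N addSn /= -[leqRHS]addn0 leq_add2l leqn0.
by rewrite size_poly_eq0 (negbTE a0).
Qed.

Lemma torsion_class_unique t t' y : torsion_class t y -> torsion_class t' y -> t = t'.
Proof.
move=> ty t'y; apply/eqP; rewrite -subr_eq0; apply/eqP/torsion_vec_lat.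
rewrite torsion_vecB.
have -> : torsion_vec t - torsion_vec t' = (y - torsion_vec t') - (y - torsion_vec t).
  by rewrite opprB [RHS]addrC addrA subrK.
exact: latB.
Qed.

Lemma torsion_vec_scale t : lat (tofrac N *: torsion_vec t).
Proof. by rewrite scalerA mulfV// scale1r; exists (torsion_num t). Qed.

Lemma torsion_class_scale t y : torsion_class t y -> lat (tofrac N *: y).
Proof.
move=> ty; rewrite -(subrK (torsion_vec t) y) scalerDr.
by apply: latD; [apply: latZ|apply: torsion_vec_scale].
Qed.

Lemma torsion_class_ex y : lat (tofrac N *: y) -> exists t, torsion_class t y.
Proof.
move=> [a _ ay]; exists (\matrix_j poly_rV (a 0 j %% N)).
exists (\row_j (a 0 j %/ N)) => //.
apply: (scalerI tN0); rewrite scalerBr -ay scalerA mulfV// scale1r.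
apply/rowP => j; rewrite !mxE -tofracM -tofracB; congr tofrac.
rewrite rowK poly_rV_K; last by rewrite -ltnS -size_N ltn_modp.
by rewrite {2}(divp_eq (a 0 j) N) addrK mulrC.
Qed.

Lemma torsion_class_calT t : t != 0 -> calT N (torsion_class t).
Proof.
move=> t0; exists (torsion_vec t); split=> //; first exact: torsion_vec_scale.
by move=> /torsion_vec_lat /eqP; rewrite (negbTE t0).
Qed.

End Lattices.

(** * Unimodular rows and the congruence subgroup *)

Section RowReduction.
Context {F : fieldType}.
Local Notation A := {poly F}.

Lemma mx_unit_inv (S : comUnitRingType) m (P Q : 'M[S]_m) : P *m Q = 1%:M -> P \in unitmx.
Proof. by case/mulmx1_unit. Qed.

(** Euclid's algorithm on the entries of a row: reduce all of them modulo the
    first, then swap a nonzero remainder to the front. *)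
Lemma row_gcd m (x : 'rV[A]_m.+1) :
  exists2 Q : 'M[A]_m.+1, Q \in unitmx & forall j, j != 0 -> (x *m Q) 0 j = 0.
Proof.
have main k : forall y : 'rV[A]_m.+1, y 0 0 != 0 -> (size (y 0 0)%R <= k)%N ->
    exists2 Q : 'M[A]_m.+1, Q \in unitmx & forall j, j != 0 -> (y *m Q) 0 j = 0.
  elim: k => [y y0|k IH y y0 yk].
    by rewrite leqn0 size_poly_eq0 (negbTE y0).
  pose u : 'rV[A]_m.+1 := \row_j if j == 0 then 0 else y 0 j %/ y 0 0.
  pose e : 'cV[A]_m.+1 := delta_mx 0 0.
  pose P : 'M[A]_m.+1 := 1%:M - e *m u.
  have ue : u *m e = 0.
    apply/matrixP => a b; rewrite !ord1 !mxE big1// => j _; rewrite !mxE.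
    by case: (eqVneq j 0) => _; rewrite ?mul0r ?mulr0.
  have PU : P \in unitmx.
    apply: (mx_unit_inv (Q := 1%:M + e *m u)).
    rewrite mulmxDr mulmx1 /P mulmxBl mul1mx mulmxA -[e *m u *m e]mulmxA ue.
    by rewrite mulmx0 mul0mx subr0 subrK.
  have yP : y *m P = \row_j if j == 0 then y 0 0 else y 0 j %% y 0 0.
    have ye : y *m e = (y 0 0)%:M.
      rewrite [e](_ : _ = (delta_mx 0 0)%R)// -colE.
      by apply/matrixP => a b; rewrite !ord1 !mxE.
    rewrite mulmxBr mulmx1 mulmxA ye mul_scalar_mx; apply/rowP => j; rewrite !mxE.
    case: eqP => [->|_]; first by rewrite mulr0 subr0.
    by rewrite {1}(divp_eq (y 0 j) (y 0 0)) mulrC addrAC subrr add0r.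
  have [all0|] := pselect (forall j, j != 0 -> (y *m P) 0 j = 0).
    by exists P.
  move=> /existsNP[j /not_implyP[j0 /eqP rj]].
  have [||Q QU QP] := IH (y *m P *m tperm_mx 0 j).
  - by rewrite -xcolE mxE tpermL.
  - rewrite -xcolE mxE tpermL yP mxE (negbTE j0).
    by rewrite -ltnS (leq_trans _ yk)// ltn_modp.
  - exists (P *m tperm_mx 0 j *m Q); first by rewrite !unitmx_mul PU unitmx_perm.
    by rewrite !mulmxA.
have [x0|/eqP x0] := eqVneq (x 0 0) 0; last by apply: (main (size (x 0 0))) => //; apply/eqP.
have [->|/eqP xn0] := eqVneq x 0.
  by exists 1%:M; rewrite ?unitmx1// => j _; rewrite mul0mx mxE.
have [j xj] : exists j, x 0 j != 0.
  apply: contrapT => no; apply: xn0; apply/rowP => j; rewrite mxE.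
  by apply: contrapT => /eqP xj; apply: no; exists j.
have [||Q QU QP] := main (size (x 0 j)) (x *m tperm_mx 0 j).
- by rewrite -xcolE mxE tpermL.
- by rewrite -xcolE mxE tpermL.
- by exists (tperm_mx 0 j *m Q); rewrite ?mulmxA// unitmx_mul unitmx_perm.
Qed.

End RowReduction.

Section CongruenceSubgroup.
Context {F : fieldType}.
Local Notation A := {poly F}.
Variable N : A.

(** The congruence is written [g = 1 + N B] rather than entrywise, so that
    products, inverses and conjugates are matrix identities. *)
Definition congruent1 m (g : 'M[A]_m) :=
  g \in unitmx /\ exists B, g = 1%:M + N *: B.

Lemma congruent1_1 m : congruent1 (1%:M : 'M[A]_m).
Proof. by split; [exact: unitmx1|exists 0; rewrite scaler0 addr0]. Qed.

Lemma congruent1_mul m (g h : 'M[A]_m) :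
  congruent1 g -> congruent1 h -> congruent1 (g *m h).
Proof.
move=> [gU [B gB]] [hU [D hD]]; split; first by rewrite unitmx_mul gU.
exists (B + D + N *: (B *m D)).
rewrite gB hD mulmxDl mul1mx mulmxDr mulmx1 -!scalemxAl -!scalemxAr.
by apply/matrixP => i j; rewrite !mxE; ring.
Qed.

Lemma congruent1_inv m (g : 'M[A]_m) : congruent1 g -> congruent1 (invmx g).
Proof.
move=> [gU [B gB]]; split; first by rewrite unitmx_inv.
exists (- (invmx g *m B)); rewrite scalerN scalemxAr.
have -> : N *: B = g - 1%:M by rewrite gB addrC addKr.
by rewrite mulmxBr mulVmx// mulmx1 opprB addrC subrK.
Qed.

Lemma congruent1_conj m (P g : 'M[A]_m) :
  P \in unitmx -> congruent1 g -> congruent1 (P *m g *m invmx P).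
Proof.
move=> PU [gU [B gB]]; split; first by rewrite !unitmx_mul PU gU unitmx_inv.
exists (P *m B *m invmx P); rewrite gB mulmxDr mulmx1 mulmxDl mulmxV//.
by rewrite -scalemxAr -scalemxAl.
Qed.

Lemma congruent1_dvd m (g : 'M[A]_m) i j : congruent1 g -> (N %| (g - 1%:M) i j)%R.
Proof. by move=> [_ [B ->]]; rewrite addrC addKr mxE dvdp_mulr. Qed.

(** A unimodular row [(1 + N a, N b, 0, ..., 0)] with inverse column
    [(w0, w1, ...)] is completed by [(N a w1, 1 - N a w0)] to a block of
    determinant [1 + N a - N a ((1 + N a) w0 + N b w1) = 1]. *)
Lemma two_entry_orbit m (x : 'rV[A]_m.+2) (b : 'rV[A]_m.+2) (w : 'cV[A]_m.+2) :
  x = delta_mx 0 0 + N *: b -> x *m w = 1%:M ->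
  (forall j : 'I_m.+2, (1 < j)%N -> x 0 j = 0) ->
  exists2 g : 'M[A]_m.+2, congruent1 g & row 0 g = x.
Proof.
move=> xb xw x2.
pose o1 : 'I_m.+2 := lift ord0 ord0.
pose T : 'M[A]_2 := \matrix_(i, j)
  if i == 0 then (if j == 0 then b 0 0 else b 0 o1)
  else (if j == 0 then b 0 0 * w o1 0 else - (b 0 0 * w 0 0)).
pose B : 'M[A]_(2 + m) := block_mx T 0 0 0.
pose g : 'M[A]_(2 + m) := 1%:M + N *: B.
have x00 : x 0 0 = 1 + N * b 0 0 by rewrite xb !mxE.
have x01 : x 0 o1 = N * b 0 o1 by rewrite xb !mxE add0r.
have xw1 : (1 + N * b 0 0) * w 0 0 + N * b 0 o1 * w o1 0 = 1.
  have := congr1 (fun M : 'M_1 => M 0 0) xw; rewrite !mxE eqxx !big_ord_recl big1.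
    by rewrite addr0 -x00 -x01.
  by move=> j _; rewrite x2 ?mul0r.
have gU : g \in unitmx.
  have -> : g = block_mx (1%:M + N *: T) 0 0 (1%:M : 'M_m).
    rewrite /g /B scalar_mx_block scale_block_mx !scaler0 add_block_mx.
    by rewrite !addr0.
  rewrite unitmxE det_ublock det1 mulr1.
  suff -> : \det (1%:M + N *: T) = 1 by exact: unitr1.
  rewrite (expand_det_row _ 0) !big_ord_recl big_ord0 /cofactor !det_mx11 !mxE /=.
  rewrite /bump /= expr0 expr1 !add0r addr0.
  transitivity (1 + N * b 0 0 - N * b 0 0 *
     ((1 + N * b 0 0) * w 0 0 + N * b 0 o1 * w o1 0)); first by ring.
  by rewrite xw1; ring.
exists g; first by split; last exists B.
apply/rowP => j; rewrite mxE /g [LHS]mxE [X in _ + X]mxE [X in X + _]mxE.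
have z0 : (0 : 'I_m.+2) = @lshift 2 m 0 by apply: val_inj.
rewrite {2}z0; case: (@split_ordP 2 m j) => k jk; rewrite jk.
  rewrite block_mxEul -jk xb !mxE /= eq_sym; congr (_ + N * _).
  by case: eqP => [k0|/eqP k0]; congr (b 0 _); apply: val_inj; rewrite jk /= ?k0//;
    case: k k0 {jk} => [[|[|]]].
rewrite block_mxEur -jk mxE mulr0 addr0 x2 ?jk//.
Qed.

(** A change of basis in the last coordinates leaves only two nonzero entries;
    it normalises the congruence subgroup, so that the previous lemma applies. *)
Lemma unimodular_row_orbit m (x : 'rV[A]_m.+1) (b : 'rV[A]_m.+1) (w : 'cV[A]_m.+1) :
  x = delta_mx 0 0 + N *: b -> x *m w = 1%:M ->
  exists2 g : 'M[A]_m.+1, congruent1 g & row 0 g = x.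
Proof.
case: m x b w => [|m] x b w xb xw.
  exists x; last by apply/rowP => j; rewrite mxE.
  split; first exact: mx_unit_inv xw.
  by exists b; rewrite xb; congr (_ + _); apply/matrixP => i j; rewrite !ord1 !mxE.
pose b' : 'rV_(1 + m.+1) := b.
have [Q QU Q0] := row_gcd (rsubmx b').
pose P : 'M[A]_(1 + m.+1) := block_mx 1%:M 0 0 Q.
have PU : P \in unitmx by rewrite unitmxE det_ublock det1 mul1r -unitmxE.
have eP : delta_mx 0 0 *m P = delta_mx 0 0 :> 'rV_(1 + m.+1).
  rewrite -rowE; apply/rowP => j; rewrite mxE.
  have -> : P 0 j = P (lshift m.+1 0) j by congr (P _ _); apply: val_inj.
  case: (split_ordP j) => k ->; first by rewrite block_mxEul !mxE !ord1.
  by rewrite block_mxEur !mxE.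
have bP : b' *m P = row_mx (lsubmx b') (rsubmx b' *m Q).
  by rewrite -[in LHS](hsubmxK b') mul_row_block !mulmx0 mulmx1 addr0 add0r.
have [|||g gN gx] := @two_entry_orbit m (x *m P) (b *m P) (invmx P *m w).
- by rewrite xb mulmxDl -scalemxAl; congr (_ + _).
- by rewrite mulmxA mulmxK.
- move=> j j1; rewrite xb mulmxDl -scalemxAl [delta_mx _ _ *m _]eP [b *m _]bP.
  rewrite mxE [X in X + _]mxE [X in _ + X]mxE.
  case: (@split_ordP 1 m.+1 j) => k jk; rewrite jk in j1 *.
    by move: j1; rewrite /= ord1.
  rewrite row_mxEr Q0 ?mulr0 ?addr0//.
  by apply: contraTneq j1 => ->.
exists (P *m g *m invmx P); first exact: congruent1_conj.
by rewrite !row_mul [row 0 P]rowE [_ *m P]eP -rowE gx mulmxK.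
Qed.

(** The rows to be completed are those of index less than [k] of [M]; being part
    of a right-invertible matrix they can be completed to an invertible one, here
    without leaving the congruence subgroup. By induction: the first row is
    unimodular, hence in the orbit of [e_0]; when it equals [e_0], the entries
    below it are multiples of [N] and the remaining rows form a smaller
    problem. *)
Lemma unimodular_rows_orbit m k (M W : 'M[A]_m) :
  (k <= m)%N -> (exists B, forall i : 'I_m, (i < k)%N -> row i M = row i (1%:M + N *: B)) ->
  (forall i j : 'I_m, (i < k)%N -> (j < k)%N -> (M *m W) i j = (i == j)%:R) ->
  exists2 g : 'M[A]_m, congruent1 g & forall i : 'I_m, (i < k)%N -> row i g = row i M.
Proof.
elim: m k M W => [|m IH] k M W.
  by move=> _ _ _; exists 1%:M; [exact: congruent1_1|case].
case: k => [|k] km [B MB] MW.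
  by exists 1%:M; [exact: congruent1_1|].
have [||g0 g0N g0M] := @unimodular_row_orbit m (row 0 M) (row 0 B) (col 0 W).
- by rewrite MB// linearD linearZ /= row1.
- apply/matrixP => i j; rewrite !ord1 [RHS]mxE -(MW 0 0)// !mxE.
  by apply: eq_bigr => l _; rewrite !mxE.
have g0U := g0N.1; have [_ [D g0V]] := congruent1_inv g0N.
pose M1 : 'M[A]_(1 + m) := M *m invmx g0; pose W1 : 'M[A]_(1 + m) := g0 *m W.
have MW1 : M1 *m W1 = M *m W by rewrite /M1 /W1 mulmxA mulmxKV.
pose B1 : 'M[A]_(1 + m) := B + D + N *: (B *m D).
have M1_row (i : 'I_m.+1) : (i < k.+1)%N -> row i M1 = row i (1%:M + N *: B1).
  move=> ik; rewrite row_mul MB// -row_mul g0V; congr row.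
  by rewrite mulmxDl mul1mx mulmxDr mulmx1 -!scalemxAl -!scalemxAr;
     apply/matrixP => a b; rewrite !mxE; ring.
have M1_0 : row 0 M1 = row 0 1%:M.
  by rewrite row_mul -g0M -row_mul mulmxV.
pose e : 'cV[A]_m := \col_i if (i < k)%N then B1 (rshift 1 i) 0 else 0.
have up (i : 'I_m) : (i < k)%N -> (@rshift 1 m i < k.+1)%N by rewrite /= add1n.
have M1e (i : 'I_m) : (i < k)%N -> M1 (rshift 1 i) 0 = N * e i 0.
  move=> ik; have := congr1 (fun x : 'rV_m.+1 => x 0 0) (M1_row _ (up _ ik)).
  by rewrite !mxE ik /= add0r.
have W1_0 (j : 'I_m) : (j < k)%N -> W1 0 (rshift 1 j) = 0.
  move=> jk; have := MW 0 (rshift 1 j) isT (up _ jk); rewrite -MW1.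
  have -> : (M1 *m W1) 0 (rshift 1 j) = (row 0 M1 *m W1) 0 (rshift 1 j).
    by rewrite -row_mul [RHS]mxE.
  by rewrite M1_0 row1 -rowE mxE.
have [|||g2 g2N g2M] := IH k (drsubmx M1) (drsubmx W1) => //.
- exists (drsubmx B1) => i ik; apply/rowP => j; rewrite !mxE.
  have := congr1 (fun x : 'rV_m.+1 => x 0 (rshift 1 j)) (M1_row _ (up _ ik)).
  by rewrite !mxE => ->; rewrite (inj_eq (@rshift_inj 1 m)).
- move=> i j ik jk; have := MW _ _ (up _ ik) (up _ jk); rewrite -MW1.
  rewrite (inj_eq (@rshift_inj 1 m)) => <-.
  rewrite [RHS]mxE big_split_ord /= big_ord1 (_ : lshift m 0 = 0); last exact: val_inj.
  rewrite W1_0// mulr0 add0r mxE; apply: eq_bigr => l _.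
  by rewrite !mxE.
have [g2U [B2 g2B]] := g2N.
pose g1 : 'M[A]_(1 + m) := block_mx 1%:M 0 (N *: e) g2.
have g1N : congruent1 g1.
  split; first by rewrite unitmxE det_lblock det1 mul1r -unitmxE.
  exists (block_mx 0 0 e B2); rewrite scale_block_mx scalar_mx_block add_block_mx.
  by rewrite !scaler0 !addr0 add0r -g2B.
exists (g1 *m g0); first exact: congruent1_mul.
move=> i ik; have -> : row i M = row i M1 *m g0 by rewrite -row_mul mulmxKV.
rewrite row_mul; congr (_ *m g0); apply/rowP => j; rewrite [LHS]mxE [RHS]mxE.
have l0 (b : 'I_1) : lshift m b = 0 by apply: val_inj; rewrite ord1.
case: (@split_ordP 1 m i) => a ia; rewrite ia in ik *.
  have -> : M1 (lshift m a) j = 1%:M (0 : 'I_m.+1) j.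
    by have := congr1 (fun x : 'rV_m.+1 => x 0 j) M1_0; rewrite l0 !mxE.
  case: (@split_ordP 1 m j) => b ->.
    by rewrite [LHS](block_mxEul 1%:M 0 (N *: e) g2) l0 !mxE !ord1.
  by rewrite [LHS](block_mxEur 1%:M 0 (N *: e) g2) !mxE.
have ak : (a < k)%N by [].
case: (@split_ordP 1 m j) => b ->.
  by rewrite [LHS](block_mxEdl 1%:M 0 (N *: e) g2) l0 M1e// mxE ord1.
rewrite [LHS](block_mxEdr 1%:M 0 (N *: e) g2); have := congr1 (fun x : 'rV_m => x 0 b) (g2M a ak).
by rewrite !mxE.
Qed.

End CongruenceSubgroup.

(** * Subspaces and their lattices of integral points *)

Lemma fraction_denominator (S : idomainType) (x : {fraction S}) :
  exists2 a : S, a != 0 & exists b : S, tofrac a * x = tofrac b.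
Proof.
elim/quotW: x => x; exists \d_x; first exact: denom_ratioP.
exists \n_x; rewrite [LHS]/GRing.mul /=; unlock tofrac; rewrite -FracField.pi_mul.
apply/eqmodP; rewrite /= FracField.equivfE /FracField.mulf.
by rewrite !numden_Ratio ?mulf_neq0 ?oner_neq0 ?denom_ratioP// mulr1 mul1r mulrC.
Qed.

Lemma row_denominator (S : idomainType) m (x : 'rV[{fraction S}]_m) :
  exists2 a : S, a != 0 & exists b : 'rV[S]_m, tofrac a *: x = map_mx (@tofrac S) b.
Proof.
have /fin_all_exists[a /fin_all_exists[b ab]] : forall j, exists a : S, exists b : S,
    a != 0 /\ tofrac a * x 0 j = tofrac b.
  by move=> j; have [a a0 [b ab]] := fraction_denominator (x 0 j); exists a, b.
exists (\prod_j a j); first by apply/prodf_neq0 => j _; case: (ab j).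
exists (\row_j (b j * \prod_(l | l != j) a l)); apply/rowP => j; rewrite !mxE.
by rewrite (bigD1 j)//= !tofracM -(proj2 (ab j)) mulrAC.
Qed.

Section SaturatedLattice.
Context {F : fieldType}.
Local Notation A := {poly F}.
Local Notation K := {fraction {poly F}}.
Local Notation toK := (map_mx (@tofrac {poly F})).

Lemma map_tofrac_unit m (Q : 'M[A]_m) : Q \in unitmx ->
  toK Q *m toK (invmx Q) = 1%:M.
Proof. by move=> QU; rewrite -map_mxM mulmxV// map_mx1. Qed.

Lemma map_tofrac_unitV m (Q : 'M[A]_m) : Q \in unitmx ->
  toK (invmx Q) *m toK Q = 1%:M.
Proof. by move=> QU; rewrite -map_mxM mulVmx// map_mx1. Qed.

(** Every subspace of [K^m] becomes a coordinate subspace after a change of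
    basis of [A^m]; hence its lattice of integral points is a direct summand. *)
Lemma coordinate_subspace m (P : 'rV[K]_m -> Prop) :
  P 0 -> (forall (a : K) x y, P x -> P y -> P (a *: x + y)) ->
  exists2 Q : 'M[A]_m, Q \in unitmx & exists2 k, (k <= m)%N &
    forall x, P x <-> forall j : 'I_m, (k <= j)%N -> (x *m toK Q) 0 j = 0.
Proof.
elim: m P => [|m IH] P P0 Plin.
  exists 1%:M; first exact: unitmx1.
  exists 0%N => // x; split=> [_ []//|_]; by rewrite [x]thinmx0.
have [allP|] := pselect (forall x, P x -> x = 0).
  exists 1%:M; first exact: unitmx1.
  exists 0%N => // x; rewrite map_mx1 mulmx1; split=> [/allP-> j _|x0].
    by rewrite mxE.
  suff -> : x = 0 by [].
  by apply/rowP => j; rewrite mxE x0.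
move=> /existsNP[x0 /not_implyP[Px0 /eqP x0n0]].
have [a a0 [b ab]] := row_denominator x0.
have [Q1 Q1U Q1b] := row_gcd b.
have PZ c x : P x -> P (c *: x) by move=> Px; rewrite -[_ *: _]addr0; apply: Plin.
have PD x y : P x -> P y -> P (x + y).
  by move=> Px Py; rewrite -[x]scale1r; apply: Plin.
pose e : 'rV[K]_m.+1 := delta_mx 0 0.
have Pe : P (e *m toK (invmx Q1)).
  pose g := tofrac ((b *m Q1) 0 0).
  have bQ : toK (b *m Q1) = g *: e.
    apply/rowP => j; rewrite [LHS]mxE [RHS]mxE [e 0 j]mxE eqxx /=.
    have [->|j0] := eqVneq j 0; first by rewrite mulr1.
    by rewrite Q1b// tofrac0 mulr0.
  have g0 : g != 0.
    apply: contraNneq x0n0 => g0; move: bQ; rewrite g0 scale0r map_mxM -ab => bQ.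
    have := congr1 (mulmx^~ (toK (invmx Q1))) bQ.
    rewrite -mulmxA map_tofrac_unit// mulmx1 mul0mx => /eqP.
    by rewrite scaler_eq0 tofrac_eq0 (negbTE a0).
  have -> : e *m toK (invmx Q1) = (g^-1 * tofrac a) *: x0.
    rewrite -scalerA ab -[e]scale1r -(mulVf g0) -scalerA -bQ -scalemxAl map_mxM.
    by rewrite -mulmxA map_tofrac_unit// mulmx1.
  exact: PZ.
pose P' (y : 'rV[K]_m) := P (row_mx (0 : 'rV_1) y *m toK (invmx Q1)).
have [||Q2 Q2U [k km Q2P]] := IH P'.
- by rewrite /P' row_mx0 mul0mx.
- move=> c x y Px Py; rewrite /P'.
  suff -> : row_mx (0 : 'rV[K]_1) (c *: x + y) = c *: row_mx 0 x + row_mx 0 y.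
    by rewrite mulmxDl -scalemxAl; apply: Plin.
  by rewrite scale_row_mx scaler0 add_row_mx addr0.
pose Q' : 'M[A]_(1 + m) := block_mx 1%:M 0 0 Q2.
have Q'U : Q' \in unitmx by rewrite unitmxE det_ublock det1 mul1r -unitmxE.
exists (Q1 *m Q'); first by rewrite unitmx_mul Q1U.
exists k.+1 => // x; pose y : 'rV[K]_(1 + m) := x *m toK Q1.
have xy : x = y *m toK (invmx Q1) by rewrite /y -mulmxA map_tofrac_unit ?mulmx1.
have yE : y = y 0 0 *: e + row_mx (0 : 'rV_1) (rsubmx y).
  apply/rowP => j; rewrite [RHS]mxE [X in X + _]mxE [e 0 j]mxE eqxx /=.
  case: (@split_ordP 1 m j) => l ->.
    rewrite [X in _ + X](row_mxEl 0 (rsubmx y)) [X in _ + X]mxE addr0.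
    rewrite (_ : lshift m l = 0) ?eqxx ?mulr1//.
    by apply: val_inj; rewrite ord1.
  by rewrite [X in _ + X](row_mxEr 0 (rsubmx y)) [X in _ + X]mxE mulr0 add0r.
have -> : P x <-> P' (rsubmx y).
  rewrite xy {1}yE mulmxDl -scalemxAl; split=> [Px|]; last by apply: PD; apply: PZ.
  rewrite /P' -[_ *m _](addKr (y 0 0 *: (e *m toK (invmx Q1)))).
  by apply: PD => //; rewrite -scaleNr; apply: PZ.
rewrite Q2P map_mxM mulmxA -/y.
have -> : y *m toK Q' = row_mx (lsubmx y) (rsubmx y *m toK Q2).
  rewrite -[in LHS](hsubmxK y) /Q' map_block_mx !map_mx0 map_mx1 mul_row_block.
  by rewrite !mulmx0 mulmx1 addr0 add0r.
split=> H j jk.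
  case: (@split_ordP 1 m j) => l jl; rewrite jl in jk *.
    by move: jk; rewrite /= ord1.
  by rewrite [LHS](row_mxEr (lsubmx y) (rsubmx y *m toK Q2)); apply: H.
by rewrite -[RHS](H (rshift 1 j) jk) [RHS](row_mxEr (lsubmx y) (rsubmx y *m toK Q2)).
Qed.

End SaturatedLattice.

Section LatticeIsomorphism.
Context {F : finFieldType} {r : nat}.
Local Notation A := {poly F}.
Local Notation V := 'rV[{fraction {poly F}}]_r.
Local Notation toK := (map_mx (@tofrac {poly F})).
Local Notation lat := (@Alattice F r).

(** In coordinates adapted to [U], the images under [f] of the first [k] basis
    vectors are rows congruent to these vectors. The right inverse [W] of the
    matrix that they form comes from the coordinates adapted to [U']: it expresses
    the elements of the lattice of [U'] through the images of that of [U]. *)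
Lemma lattice_iso_extends (N : A) (U U' : {vspace V}) (f : {linear V -> V}) :
  (forall x, x \in U -> f x \in U') ->
  (forall x, x \in U -> f x = 0 -> x = 0) ->
  (forall x, x \in U -> lat x -> exists b, f x = x + toK (N *: b)) ->
  (forall y, y \in U' -> lat y -> exists x, [/\ x \in U, lat x & f x = y]) ->
  exists2 g : 'M[A]_r, congruent1 N g & forall x, x \in U -> f x = x *m toK g.
Proof.
move=> fU f_inj fN f_onto.
have coord (W : {vspace V}) := @coordinate_subspace F r (fun x => x \in W)
  (mem0v W) (fun a x y xW yW => memvD (memvZ a xW) yW).
have [Q QU [k km UQ]] := coord U; have [Q' Q'U [k' _ UQ']] := coord U'.
pose e (i : 'I_r) : 'rV[A]_r := delta_mx 0 i.
pose u i : V := toK (e i *m invmx Q); pose u' i : V := toK (e i *m invmx Q').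
have lat_u i : lat (u i) by exists (e i *m invmx Q).
have lat_u' i : lat (u' i) by exists (e i *m invmx Q').
have eK (i j : 'I_r) : (toK (e i)) 0 j = (j == i)%:R.
  by rewrite !mxE eqxx /=; case: eqP => _; rewrite ?tofrac1 ?tofrac0.
have uU (i : 'I_r) : (i < k)%N -> u i \in U.
  move=> ik; apply/UQ => j kj; rewrite /u map_mxM -mulmxA map_tofrac_unitV// mulmx1 eK.
  by case: eqP => // ji; move: kj; rewrite ji leqNgt ik.
have uU' (i : 'I_r) : (i < k')%N -> u' i \in U'.
  move=> ik; apply/UQ' => j kj; rewrite /u' map_mxM -mulmxA map_tofrac_unitV// mulmx1 eK.
  by case: eqP => // ji; move: kj; rewrite ji leqNgt ik.
have /fin_all_exists[b fu] (i : 'I_r) : exists b, (i < k)%N -> f (u i) = u i + toK (N *: b).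
  have [ik|ik] := ltnP i k; last by exists 0.
  by have [b fb] := fN _ (uU i ik) (lat_u i); exists b.
have /fin_all_exists[s fs] (j : 'I_r) : exists s : 'rV[A]_r, (j < k')%N ->
    toK (s *m invmx Q) \in U /\ f (toK (s *m invmx Q)) = u' j.
  have [jk|jk] := ltnP j k'; last by exists 0.
  have [x [xU [a _ ax] fx]] := f_onto _ (uU' j jk) (lat_u' j).
  by exists (a *m Q) => _; rewrite mulmxK// ax.
pose B := (\matrix_i b i) *m Q.
pose M : 'M[A]_r := 1%:M + N *: B.
pose S : 'M[A]_r := \matrix_j if (j < k')%N then s j else 0.
have M_row (i : 'I_r) : (i < k)%N -> toK (row i M *m invmx Q) = f (u i).
  move=> ik; rewrite fu// linearD linearZ /= row1 /B row_mul rowK mulmxDl map_mxD.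
  by rewrite -scalemxAl mulmxK.
have MW_row (i : 'I_r) : (i < k)%N -> row i M *m (invmx Q *m Q' *m S) = e i.
  (* The coordinates of [f (u i)] on the basis [u'] of the lattice of [U']. *)
  move=> ik; pose t := row i M *m invmx Q *m Q'.
  have tE : row i M *m (invmx Q *m Q' *m S) = t *m S by rewrite /t !mulmxA.
  have t0 (j : 'I_r) : (k' <= j)%N -> t 0 j = 0.
    move=> kj; apply/eqP; rewrite -tofrac_eq0; apply/eqP.
    have <- : (f (u i) *m toK Q') 0 j = tofrac (t 0 j).
      by rewrite -M_row// -map_mxM mxE.
    by move/UQ': (fU _ (uU i ik)); apply.
  have tS : t *m S = \sum_(j < r | (j < k')%N) t 0 j *: s j.
    rewrite mulmx_sum_row [RHS]big_mkcond; apply: eq_bigr => j _.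
    by rewrite rowK; case: ifP => // _; rewrite scaler0.
  have tu : t *m invmx Q' = \sum_(j < r | (j < k')%N) t 0 j *: (e j *m invmx Q').
    rewrite [in LHS](row_sum_delta t) mulmx_suml [RHS]big_mkcond; apply: eq_bigr => j _.
    by case: ltnP => [|/t0 ->]; rewrite ?scale0r ?mul0mx// -scalemxAl.
  have ts : toK (t *m S *m invmx Q) = u i.
    apply/eqP; rewrite -subr_eq0; apply/eqP; apply: f_inj.
      apply: rpredB; last exact: uU.
      rewrite tS mulmx_suml map_mx_sum; apply: rpred_sum => j jk.
      by rewrite -scalemxAl map_mxZ; apply: rpredZ; case: (fs j jk).
    rewrite linearB /= -M_row// tS mulmx_suml map_mx_sum linear_sum /=.
    rewrite (_ : row i M *m invmx Q = t *m invmx Q'); last by rewrite /t mulmxK.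
    rewrite tu map_mx_sum -sumrB big1// => j jk.
    rewrite -!scalemxAl !map_mxZ linearZ /=.
    by rewrite (proj2 (fs j jk)) subrr.
  have tse : t *m S *m invmx Q = e i *m invmx Q.
    apply/rowP => j; apply/eqP; rewrite -tofrac_eq; apply/eqP.
    by have := congr1 (fun x : V => x 0 j) ts; rewrite !mxE.
  by rewrite tE -[LHS](mulmxKV QU) tse mulmxKV.
have [|i j ik jk|g gN gM] :=
  unimodular_rows_orbit (M := M) (W := invmx Q *m Q' *m S) (N := N) km.
- by exists B.
- have -> : (M *m (invmx Q *m Q' *m S)) i j = (row i M *m (invmx Q *m Q' *m S)) 0 j.
    by rewrite -row_mul [RHS]mxE.
  by rewrite MW_row// mxE eqxx eq_sym.
exists (Q *m g *m invmx Q); first exact: congruent1_conj.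
move=> x xU; pose c := x *m toK Q.
have c0 (j : 'I_r) : (k <= j)%N -> c 0 j = 0 by move/UQ: xU; apply.
have xE : x = c *m toK (invmx Q) by rewrite /c -mulmxA map_tofrac_unit// mulmx1.
have cE : c = \sum_(j < r | (j < k)%N) c 0 j *: toK (e j).
  rewrite [LHS]row_sum_delta [RHS]big_mkcond; apply: eq_bigr => j _.
  case: ltnP => [_|/c0 ->]; last by rewrite scale0r.
  by rewrite map_delta_mx.
rewrite [in LHS]xE cE mulmx_suml linear_sum /=.
have -> : x *m toK (Q *m g *m invmx Q) = c *m toK (g *m invmx Q).
  by rewrite /c -[RHS]mulmxA -map_mxM !mulmxA.
rewrite [in RHS]cE mulmx_suml; apply: eq_bigr => j jk.
rewrite -!scalemxAl linearZ /= -!map_mxM -/(u j) -M_row// -gM//.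
by rewrite mulmxA -rowE.
Qed.

End LatticeIsomorphism.

(** * Separation of points by the Eisenstein series *)

Lemma linear_eq (S : pzSemiRingType) (U : lSemiModType S) (W : nmodType)
    (s : S -> W -> W) (f g : {linear U -> W | s}) : f =1 g -> f = g.
Proof.
case: f => f cf; case: g => g cg /= /funext fg; subst g; congr GRing.Linear.Pack.
case: cf cg => [[a] [b]] [[a'] [b']].
by rewrite (Prop_irrelevance a a') (Prop_irrelevance b b').
Qed.

Section Separation.
Context {F : finFieldType} {R : realType} {C : fieldType} {v : nonarch_absval R C}.
Context {iota : {rmorphism {fraction {poly F}} -> valued v}}.
Context {r : nat}.
Local Notation A := {poly F}.
Local Notation V := 'rV[{fraction {poly F}}]_r.
Local Notation lat := (@Alattice F r).

Lemma discrete_embedding_eq (U : {vspace V}) (i i' : discrete_embedding iota U) :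
  i =1 i' -> i = i'.
Proof.
case: i => [i i_inj i_fin]; case: i' => [i' i'_inj i'_fin] /= ii'.
have e : i = i' by apply: linear_eq.
subst i'; by rewrite (Prop_irrelevance i_inj i'_inj) (Prop_irrelevance i_fin i'_fin).
Qed.

Lemma PsiBar_eq (w w' : PsiBar iota r) :
  (forall x, (x \in val (tag w)) = (x \in val (tag w'))) ->
  (forall (x : subvs_of (val (tag w))) (x' : subvs_of (val (tag w'))),
     vsval x = vsval x' -> tagged w x = tagged w' x') ->
  w = w'.
Proof.
case: w => [[U U0] i]; case: w' => [[U' U'0] i'] /= UU' ii'.
have e : U = U' by apply/vspaceP.
subst U'; rewrite (Prop_irrelevance U'0 U0); congr existT.
by apply: discrete_embedding_eq => x; apply: ii'.
Qed.

Section Lattice.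
Variables (U : {vspace V}) (i : discrete_embedding iota U).
Local Notation L := (@lattice_of F r U).

Lemma dembZ (a : {fraction A}) (x : subvs_of U) : i (a *: x) = iota a * i x.
Proof. exact: linearZ. Qed.

Lemma dembP a x y :
  i (a *: x + y) = iota a * i x + i y.
Proof. exact: linearP. Qed.

Lemma vsvalZ (a : {fraction A}) (x : subvs_of U) :
  vsval (a *: x) = a *: vsval x.
Proof. by []. Qed.

Lemma lattice_ofB (x y : subvs_of U) : L x -> L y -> L (x - y).
Proof. exact: latB. Qed.

Lemma lattice_of_fin (B : R) : finite_set [set x | L x /\ v (i x) <= B].
Proof.
have fin := demb_discrete i 0 (B + 1).
apply: sub_finite_set (finite_preimage _ fin).
  move=> x /= [xL xB]; split; first by exists x.
  rewrite ballEmdist /= /mdist /= /vdist sub0r vN.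
  by apply: le_lt_trans xB _; rewrite ltrDl.
by move=> x y _ _; apply: demb_inj.
Qed.

End Lattice.

Lemma Eis1_has_sum (w : PsiBar iota r) (u : set V) s :
  has_sum (fun x : subvs_of (val (tag w)) =>
    if vsval x \in u then (tagged w x)^-1 else 0) s -> Eis1 u w = s.
Proof.
move=> us; rewrite /Eis1.
rewrite [X in fmap X _](_ : _ = fun S : {fset subvs_of (val (tag w))} =>
  \sum_(x <- S) if vsval x \in u then (tagged w x)^-1 else 0); first exact: lim_has_sum us.
apply/funext => S; rewrite big_mkcond; apply: eq_bigr => x _.
by have [->|//] := eqVneq x 0; rewrite (raddf0 (tagged w)) invr0 !if_same.
Qed.

Hypothesis hC : is_Cinfty iota.
Variables (N : A) (d : nat).
Hypotheses (d_gt0 : (0 < d)%N) (size_N : size N = d.+1).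
Local Notation n := (iota (tofrac N)).
Local Notation tc := (torsion_class (r := r) N (d := d)).

Let N0 : N != 0. Proof. by rewrite -size_poly_eq0 size_N. Qed.
Let tN0 : (tofrac N : {fraction A}) != 0. Proof. by rewrite tofrac_eq0. Qed.

Lemma iotaN_gt1 : 1 < v n.
Proof.
rewrite (Cinfty_absv hC N0) size_N /= exprn_egt1 -?lt0n//.
by rewrite ltr1n; apply: card_finNzRing_gt1.
Qed.

Lemma demb_torsion_classes (U : {vspace V}) (i : discrete_embedding iota U) :
  torsion_classes n 0 i (@lattice_of F r U) (fun x => tofrac N *: x)
    (fun t => [set x | tc t (vsval x)]).
Proof.
split.
- exact: demb_inj.
- exact: lat0.
- exact: lattice_ofB.
- exact: lattice_of_fin.
- exists (fun x => (tofrac N)^-1 *: x) => x.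
    by rewrite scalerA mulVf// scale1r.
  by rewrite scalerA mulfV// scale1r.
- by move=> x; apply: dembZ.
- move=> t c /= ct x.
  rewrite /torsion_class /lattice_of /= in ct *; split=> xt.
    have -> : vsval x - vsval c = (vsval x - torsion_vec N t) - (vsval c - torsion_vec N t).
      by rewrite opprB addrA subrK.
    exact: latB.
  by rewrite -[vsval x](subrK (vsval c)) -addrA; apply: latD.
- by move=> x; rewrite /= /torsion_class /= torsion_vec0 subr0.
- by move=> t t' x; apply: torsion_class_unique.
- move=> x; split=> [|[t]]; first exact: torsion_class_ex.
  exact: torsion_class_scale.
Qed.

Lemma has_sum_Eis1 (w : PsiBar iota r) t :
  has_sum (fun x : subvs_of (val (tag w)) =>
    if x \in [set x | tc t (vsval x)] then (tagged w x)^-1 else 0) (Eis1 (tc t) w).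
Proof.
have [s ws] := class_summable (Cinfty_complete hC) (demb_torsion_classes (tagged w)) t.
by rewrite (Eis1_has_sum ws).
Qed.

(** The torsion classes of the two points match, and a vector of [N^-1 A^r] lies
    in a torsion class. *)
Lemma points_match (w w' : PsiBar iota r) :
  (forall t, t != 0 -> Eis1 (tc t) w = Eis1 (tc t) w') ->
  forall c : subvs_of (val (tag w)), lat (tofrac N *: vsval c) ->
  exists2 c' : subvs_of (val (tag w')), lat (vsval c' - vsval c) & tagged w' c' = tagged w c.
Proof.
move=> ww' c cN; have [t ct] := torsion_class_ex size_N cN.
pose E t := if t == 0 then 0 else Eis1 (tc t) w.
have [|||c' c't ic'] := classes_match (Cinfty_complete hC) iotaN_gt1
  (demb_torsion_classes (tagged w)) (demb_torsion_classes (tagged w')) (E := E) _ _ _ ct.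
- by rewrite /E eqxx.
- by move=> t' t'0; rewrite /E (negbTE t'0); apply: has_sum_Eis1.
- by move=> t' t'0; rewrite /E (negbTE t'0) ww'//; apply: has_sum_Eis1.
exists c' => //.
have -> : vsval c' - vsval c = (vsval c' - torsion_vec N t) - (vsval c - torsion_vec N t).
  by rewrite opprB addrA subrK.
exact: latB.
Qed.

(** Up to a scalar, every vector of the space lies in [N^-1 A^r]. *)
Lemma values_match (w w' : PsiBar iota r) :
  (forall t, t != 0 -> Eis1 (tc t) w = Eis1 (tc t) w') ->
  forall x : subvs_of (val (tag w)),
  exists x' : subvs_of (val (tag w')), tagged w' x' = tagged w x.
Proof.
move=> ww' x; have [a a0 [b ab]] := row_denominator (vsval x).
have ta0 : (tofrac a : {fraction A}) != 0 by rewrite tofrac_eq0.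
have [|c' _ ic'] := points_match ww' (c := (tofrac N)^-1 *: (tofrac a *: x)).
  by rewrite !vsvalZ (scalerKV tN0) ab; exact: lat_map.
exists ((tofrac a)^-1 *: (tofrac N *: c')).
by rewrite !dembZ ic' -!dembZ (scalerKV tN0) (scalerK ta0).
Qed.

(** The map [phi] sends [x] to the vector on which [w'] takes the value of [w] at
    [x]. By [points_match] applied to [N^-1 x], it moves [x] in [A^r] by an
    element of [N A^r], and it maps lattice onto lattice by symmetry. *)
Lemma lattice_map_exists (w w' : PsiBar iota r) :
  (forall t, t != 0 -> Eis1 (tc t) w = Eis1 (tc t) w') ->
  exists2 g : 'M[A]_r, congruent1 N g &
  exists2 phi : subvs_of (val (tag w)) -> subvs_of (val (tag w')),
    (forall x, tagged w' (phi x) = tagged w x) &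
    (forall x, vsval (phi x) = vsval x *m map_mx (@tofrac A) g).
Proof.
move=> ww'; have w'w t : t != 0 -> Eis1 (tc t) w' = Eis1 (tc t) w by move/ww'.
set U := val (tag w); set U' := val (tag w').
set i := tagged w; set i' := tagged w'.
have [phi phiE] := choice (values_match ww').
have phi_unique x x' : i' x' = i x -> phi x = x'.
  by move=> ix; apply: (@demb_inj _ _ _ _ _ _ _ i'); rewrite phiE.
have phi_lin a x y : phi (a *: x + y) = a *: phi x + phi y.
  apply: phi_unique.
  by rewrite [LHS]dembP [RHS]dembP !phiE.
pose f0 (x : V) : V := vsval (phi (vsproj U x)).
have f0_lin : linear f0 by move=> a x y; rewrite /f0 linearP phi_lin linearP.
pose f : {linear V -> V} := HB.pack f0 (GRing.isLinear.Build _ _ _ _ f0 f0_lin).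
have fE (x : subvs_of U) : f (vsval x) = vsval (phi x) by rewrite /f /= /f0 vsvalK.
have subE (W : {vspace V}) (x : V) : x \in W -> exists y : subvs_of W, x = vsval y.
  by move=> xW; exists (vsproj W x); rewrite vsprojK.
have [||||g gN gf] := @lattice_iso_extends F r N U U' f.
- by move=> _ /subE[x ->]; rewrite fE; apply: subvsP.
- move=> _ /subE[x ->]; rewrite fE => fx.
  have px : phi x = 0 by apply: val_inj.
  suff -> : x = 0 by [].
  apply: (@demb_inj _ _ _ _ _ _ _ i); rewrite raddf0 -[LHS]phiE px.
  exact: raddf0.
- move=> _ /subE[x ->] xL; rewrite fE.
  have [|c' [b _ bc] ic'] := points_match ww' (c := (tofrac N)^-1 *: x).
    rewrite vsvalZ (scalerKV tN0); exact: xL.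
  exists b; rewrite map_mxZ bc.
  rewrite (phi_unique x (tofrac N *: c')); last first.
    by rewrite dembZ ic' -dembZ (scalerKV tN0).
  rewrite !vsvalZ scalerBr (scalerKV tN0).
  by rewrite addrC subrK.
- move=> _ /subE[y ->] yL.
  have [|c [b _ bc] ic] := points_match w'w (c := (tofrac N)^-1 *: y).
    rewrite vsvalZ (scalerKV tN0); exact: yL.
  exists (vsval (tofrac N *: c)); split; first exact: subvsP.
    have -> : vsval (tofrac N *: c)
        = tofrac N *: (vsval c - vsval ((tofrac N)^-1 *: y)) + vsval y.
      by rewrite !vsvalZ scalerBr (scalerKV tN0) subrK.
    by apply: latD => //; apply: latZ; exists b.
  rewrite fE; congr vsval; apply: phi_unique.
  by rewrite dembZ ic -dembZ (scalerKV tN0).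
exists g => //; exists phi => // x.
by rewrite -fE gf ?subvsP.
Qed.

(** A point is determined by the values of its embedding, and [Gact] transports
    them by the inverse of its matrix: hence the witness [invmx g]. *)
Lemma separation (w w' : PsiBar iota r) :
  (forall t, t != 0 -> Eis1 (tc t) w = Eis1 (tc t) w') ->
  exists2 g : Gamma F r, in_GammaN N g & w' = Gact g w.
Proof.
move=> ww'; have w'w t : t != 0 -> Eis1 (tc t) w' = Eis1 (tc t) w by move/ww'.
have [g gN [phi phiE phig]] := lattice_map_exists ww'.
have gVN := congruent1_inv gN; have gU := gN.1.
have vU : invmx g \in unitmx by rewrite unitmx_inv.
have phiV (x' : subvs_of (val (tag w'))) : exists x, phi x = x'.
  have [x ix] := values_match w'w x'; exists x.
  by apply: (@demb_inj _ _ _ _ _ _ _ (tagged w')); rewrite phiE.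
pose h : Gamma F r := exist _ (invmx g) vU.
have rmul_phi x : rmul h (vsval (phi x)) = vsval x.
  by rewrite /rmul /= phig -mulmxA map_tofrac_unit// mulmx1.
exists h; first by move=> j k; apply: congruent1_dvd.
apply: PsiBar_eq => [x|x x' xx'].
  rewrite /= mem_space_act; apply/idP/idP => [xU|xU].
    have [y yx] := phiV (vsproj _ x).
    by rewrite -(vsprojK xU) -yx rmul_phi subvsP.
  suff <- : vsval (phi (vsproj _ (rmul h x))) = x by apply: subvsP.
  apply: (can_inj (rmulK h)); rewrite rmul_phi.
  exact: vsprojK.
have [y yx] := phiV x.
rewrite /= /emb_act -xx' -yx phiE rmul_phi.
by congr (tagged w _); rewrite vsvalK.
Qed.

Lemma Gact_scale (g : Gamma F r) (c : {c : valued v | c != 0}) (w : PsiBar iota r) :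
  Gact g (Cscale c w) = Cscale c (Gact g w).
Proof. by apply: PsiBar_eq => // x x' xx'; congr (_ * tagged w _); rewrite xx'. Qed.

Lemma Cscale_mul (a b c : {c : valued v | c != 0}) (w : PsiBar iota r) :
  val a * val b = val c -> Cscale a (Cscale b w) = Cscale c w.
Proof.
move=> abc; apply: PsiBar_eq => // x x' xx'.
rewrite /= /emb_scale /= /emb_scale mulrA abc; congr (_ * tagged w _).
exact: val_inj.
Qed.

Lemma Eis1_scale (c : {c : valued v | c != 0}) (w : PsiBar iota r) t :
  Eis1 (tc t) (Cscale c w) = (val c)^-1 * Eis1 (tc t) w.
Proof.
apply: Eis1_has_sum; have := has_sumZ (c := (val c)^-1) (has_sum_Eis1 (w := w) (t := t)).
apply: eq_has_sum => x /=; rewrite /emb_scale invfM.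
have -> : (x \in [set x | tc t (vsval x)]) = (vsval x \in tc t) by [].
by case: ifP => _; rewrite ?mulr0.
Qed.

End Separation.

Theorem proposition4p8
    (F : finFieldType) (R : realType) (C : fieldType) (v : nonarch_absval R C)
    (iota : {rmorphism {fraction {poly F}} -> valued v})
    (hC : is_Cinfty iota)
    (r : nat) (hr : (2 <= r)%N)
    (N : {poly F}) (d : nat) (hd : (1 <= d)%N)
    (hN : N \is monic) (hNd : size N = d.+1) :
  (forall w w' : PsiBar iota r,
     (forall u, calT N u -> Eis1 u w = Eis1 u w') ->
     exists2 g : Gamma F r, in_GammaN N g & w' = Gact g w)
  /\
  (forall w w' : PsiBar iota r,
     (exists2 c : valued v, c != 0 &
        forall u, calT N u -> Eis1 u w' = c * Eis1 u w) ->
     exists2 g : Gamma F r, in_GammaN N g &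
       Gact g @` Omega_class w = Omega_class w').
Proof.
split=> [w w' ww'|w w' [c c0 ww']].
  apply: (separation hC hd hNd) => t t0; apply: ww'.
  exact: torsion_class_calT.
have cV0 : c^-1 != 0 by rewrite invr_eq0.
(* The series have weight one: those of [c^-1 w] are [c] times those of [w]. *)
pose a : {c : valued v | c != 0} := exist _ c^-1 cV0.
have [g gN w'E] : exists2 g : Gamma F r, in_GammaN N g & w' = Gact g (Cscale a w).
  apply: (separation hC hd hNd) => t t0.
  rewrite (Eis1_scale hC hNd) /= invrK ww'//.
  exact: torsion_class_calT.
exists g => //; rewrite w'E; apply/seteqP; split=> [_ [_ [b _ <-] <-]|_ [b _ <-]].
  have bc0 : val b * c != 0 by rewrite mulf_neq0// (valP b).
  exists (exist _ (val b * c) bc0) => //.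
  by rewrite !Gact_scale; apply: Cscale_mul; rewrite /= mulfK.
have bc0 : val b * c^-1 != 0 by rewrite mulf_neq0// (valP b).
pose b' : {c : valued v | c != 0} := exist _ (val b * c^-1) bc0.
exists (Cscale b' w); first by exists b'.
by rewrite !Gact_scale; apply/esym/Cscale_mul.
Qed.
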